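(* Let $\widetilde{\mathsf{W}}=\operatorname{diag}(\mathsf{W}_\alpha)$ and $\widetilde{\mathsf{M}}=\operatorname{diag}(\mathsf{M}_\beta)$ be the diagonals of the $\alpha$-weighted $L^2$ mass matrix on $W_h$ and of the $\beta$-weighted mass matrix on the Raviart--Thomas space $\boldsymbol{V}_h$, both in the interpolation--histopolation basis, and let $\mathsf{D}$ be the discrete divergence matrix in these bases. Then the approximate Schur complement $$\widetilde{\mathsf{S}}=\widetilde{\mathsf{W}}^{-1}+\mathsf{D}\,\widetilde{\mathsf{M}}^{-1}\mathsf{D}^{T}$$ is an M-matrix.
   Context: Setting: $d\in\{2,3\}$, $\Omega\subset\mathbb{R}^d$, $p\ge1$. $\mathcal{T}$ is a conforming mesh of $\Omega$ by quadrilaterals ($d=2$) or hexahedra ($d=3$); each $\kappa\in\mathcal{T}$ is the image $T_\kappa([0,1]^d)$ of the unit cube under a transformation $T_\kappa$ with Jacobian $J_\kappa$, $\det J_\kappa>0$. The coefficients $\alpha,\beta$ are scalar functions on $\Omega$ such that $\mathsf{W}_\alpha$ and $\mathsf{M}_\beta$ below are positive-definite. Spaces: $\boldsymbol{V}_h$ is the degree-$p$ Raviart--Thomas space: all $\boldsymbol v\in\boldsymbol H(\mathrm{div};\Omega)$ whose restriction to each $\kappa$ is the Piola image $\det(J_\kappa)^{-1}J_\kappa\hat{\boldsymbol v}$ of some $\hat{\boldsymbol v}$ in $\mathcal{Q}_{p,p-1,p-1}\times\mathcal{Q}_{p-1,p,p-1}\times\mathcal{Q}_{p-1,p-1,p}$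 ($d=3$; analogously $\mathcal{Q}_{p,p-1}\times\mathcal{Q}_{p-1,p}$ for $d=2$), where $\mathcal{Q}_{p_1,p_2,p_3}$ denotes polynomials of degree at most $p_i$ in $x_i$. $W_h$ is the space of $w\in L^2(\Omega)$ whose restriction to each $\kappa$ is $\det(J_\kappa)^{-1}\hat w$ with $\hat w\in\mathcal{Q}_{p-1}$ (degree at most $p-1$ in each variable). Interpolation--histopolation basis: the reference cube $[0,1]^d$ is subdivided into $p^d$ box subelements with vertices at the $d$-fold Cartesian product of the $p+1$ Gauss--Lobatto points on $[0,1]$; mapping by the $T_\kappa$ gives a subelement mesh of $\Omega$. The degrees of freedom of $\boldsymbol{V}_h$ are the integrals of the normal component over each subelement face (with a fixed choice of normal for each face); the degrees of freedom of $W_h$ are the integrals over each subelement volume. The bases are those dual to these degrees of freedom. Matrices: with vectors of coefficients $\mathsf u,\mathsf v$ of $\boldsymbol u,\boldsymbol v\in\boldsymbol V_h$ and $\mathsf q,\mathsf r$ of $q,r\in W_h$, define $\mathsf v^T\mathsf M_\beta\mathsf u=\int_\Omega\beta\,\boldsymbol u\cdot\boldsymbol v$ and $\mathsf r^T\mathsf W_\alpha\mathsf q=\int_\Omega\alpha\,q\,r$. $\mathsf D$ is the matrix of $\nabla\cdot:\boldsymbol V_h\to W_h$. It has entries $\mathsf D_{ij}=\sigma_{ij}\in\{1,-1\}$ if $j$ is a face of the subelement volume $i$ (the sign being the orientation of face $j$ relative to volume $i$, so the two volumes sharing a face receive opposite signs), and $\mathsf D_{ij}=0$ otherwise. Equivalently,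 with $\mathcal F(i)$ the set of faces of the subelement volume $i$, $\widetilde{\mathsf S}_{ii}=\widetilde{\mathsf W}_{ii}^{-1}+\sum_{k\in\mathcal F(i)}\widetilde{\mathsf M}_{kk}^{-1}$; for $i\ne j$, $\widetilde{\mathsf S}_{ij}=-\widetilde{\mathsf M}_{kk}^{-1}$ if $i$ and $j$ share the common face $k=k_{ij}$, and $\widetilde{\mathsf S}_{ij}=0$ otherwise. M-matrix (standard meaning): a real square matrix with nonpositive off-diagonal entries that is nonsingular with entrywise nonnegative inverse. *)

(* Defs.v *)
From mathcomp Require Import all_boot all_order all_algebra.
From mathcomp Require Import all_classical all_reals all_analysis.

Set Implicit Arguments.
Unset Strict Implicit.
Unset Printing Implicit Defensive.

Import Order.TTheory GRing.Theory Num.Theory.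
Import numFieldNormedType.Exports.

Local Open Scope classical_set_scope.
Local Open Scope ring_scope.

Section Matrices.
Variables (R : realType) (n : nat).
Implicit Type A : 'M[R]_n.

Definition posdef A :=
  A^T = A /\ forall x : 'cV[R]_n, x != 0 -> 0 < (x^T *m A *m x) ord0 ord0.

Definition diag_part A : 'M[R]_n := diag_mx (\row_i A i i).

Definition is_M_matrix A :=
  [/\ forall i j, i != j -> A i j <= 0,
      A \in unitmx
    & forall i j, 0 <= invmx A i j].

End Matrices.

Section Euclidean.
Variables (R : realType) (d : nat).
Local Notation point := 'rV[R]_d.

Definition dot (u v : point) : R := \sum_l u ord0 l * v ord0 l.

(* The norm that the library puts on 'rV[R]_d is the sup norm. *)
Definition enorm (u : point) : R := Num.sqrt (dot u u).

Definition box (a b : point) : set point :=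
  [set x : point | forall l, a ord0 l <= x ord0 l <= b ord0 l].

(* Face of any dimension: [e l = None] leaves coordinate [l] free, whereas
   [Some false] and [Some true] fix it to its minimum and maximum. *)
Definition box_face (a b : point) (e : 'I_d -> option bool) : set point :=
  box a b `&` [set x : point | forall l s, e l = Some s ->
                 x ord0 l = (if s then b else a) ord0 l].

Definition update (x : point) (l : 'I_d) (t : R) : point :=
  \row_k (if k == l then t else x ord0 k).

(* Iterated Lebesgue integral of [f] over the coordinates listed in [s], each
   coordinate [l] running over [a_l, b_l]; the other coordinates are those of
   [x]. *)
Fixpoint iint (s : seq 'I_d) (a b : point) (f : point -> \bar R) (x : point)
    : \bar R :=
  if s is l :: s' then
    (\int[lebesgue_measure]_(t in `[a ord0 l, b ord0 l])
       iint s' a b f (update x l t))%E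
  else f x.

(* Integral over a d-dimensional box. *)
Definition box_int (a b : point) (f : point -> \bar R) : \bar R :=
  iint (enum 'I_d) a b f 0.

Definition C1_on (W : normedModType R) (U : set point) (f : point -> W) :=
  (forall x, U x -> differentiable f x) /\
  (forall v x, U x -> {for x, continuous ('D_v f)}).

(* C^1 diffeomorphism from some open neighbourhood of [A] onto an open set. *)
Definition C1_diffeo_near (A : set point) (F : point -> point) :=
  exists (U : set point) (G : point -> point),
    [/\ open U, A `<=` U & open (F @` U)] /\
    [/\ forall x, U x -> G (F x) = x, C1_on U F & C1_on (F @` U) G].

(* Any two distinct cells [F i (box (a i) (b i))] are disjoint or meet in a
   proper face common to both. *)
Definition conforming (I : eqType) (F : I -> point -> point)
    (a b : I -> point) :=
  forall i j, i != j ->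
    let X := F i @` box (a i) (b i) `&` F j @` box (a j) (b j) in
    X = set0 \/
    exists e e' : 'I_d -> option bool,
      [/\ exists l, e l <> None, exists l, e' l <> None,
          X = F i @` box_face (a i) (b i) e
        & X = F j @` box_face (a j) (b j) e'].

(* The polynomials of degree at most [q l] in the l-th variable. *)
Definition tensor_poly (q : 'I_d -> nat) (f : point -> R) :=
  exists c : {dffun forall l : 'I_d, 'I_(q l).+1} -> R,
    forall x, f x = \sum_k c k * \prod_l x ord0 l ^+ k l.

End Euclidean.

Section GaussLobatto.
Variables (R : realType) (p : nat).

(* Legendre polynomial of degree p shifted to [0,1], by Rodrigues' formula. *)
Definition legendre01 : {poly R} :=
  (p`!%:R)^-1 *: ((('X^2 - 'X) ^+ p)^`(p))%R.

Definition gauss_lobatto (g : 'I_p.+1 -> R) :=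
  [/\ {homo g : i j / (i < j)%N >-> i < j},
      g ord0 = 0, g ord_max = 1
    & forall i : 'I_p.+1, (0 < i < p)%N -> root (legendre01^`())%R (g i)].

End GaussLobatto.

Section Mesh.
Variables (R : realType) (d : nat) (K : finType).
Variables (Omega : set 'rV[R]_d) (T : K -> 'rV[R]_d -> 'rV[R]_d).
Local Notation point := 'rV[R]_d.

Definition ones : point := const_mx 1.
Definition unit_cube : set point := box 0 ones.

(* The library's [jacobian] acts on row vectors: it is the transpose of the
   usual Jacobian matrix, with l-th row the partial derivative in direction l. *)
Definition jac (k : K) (x : point) : 'M[R]_d := jacobian (T k) x.

Definition is_mesh :=
  [/\ forall k, C1_diffeo_near unit_cube (T k),
      forall k x, unit_cube x -> 0 < \det (jac k x),
      conforming T (fun=> 0) (fun=> ones)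
    & Omega = (\bigcup_(k in [set: K]) (T k @` unit_cube))°].

(* Functions on Omega up to null sets are represented by their restrictions
   [f k] to the closed elements, so that the two traces on an interface between
   elements may differ. *)
Definition bscalar := K -> point -> R.
Definition bvector := K -> point -> point.

(* Integral over the element k, through its parametrization by T k. *)
Definition elem_int (k : K) (f : point -> R) : R :=
  fine (box_int 0%R ones (fun x => (f (T k x) * \det (jac k x))%:E)).

Definition Omega_int (f : bscalar) : R := \sum_k elem_int k (f k).

(* Square-integrability over Omega; measurability is Borel measurability. *)
Definition L2 (f : bscalar) :=
  forall k,
    (forall Y : set R, measurable Y ->
       <<s [set U : set point | open U] >>
         (unit_cube `&` (fun x => f k (T k x)) @^-1` Y)) /\
    (box_int 0%R ones
       (fun x => ((f k (T k x)) ^+ 2 * \det (jac k x))%:E) < +oo)%E.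

Definition test_function (h : point -> R) :=
  C1_on [set: point] h /\
  exists C : set point,
    [/\ compact C, C `<=` Omega & forall y, ~ C y -> h y = 0].

(* [w] is the weak divergence of [u] in Omega. *)
Definition weak_div (u : bvector) (w : bscalar) :=
  forall h, test_function h ->
    Omega_int (fun k y => \sum_l u k y ord0 l * 'D_(delta_mx ord0 l) h y) =
    - Omega_int (fun k y => w k y * h y).

Definition Hdiv (u : bvector) :=
  (forall l, L2 (fun k y => u k y ord0 l)) /\ exists2 w, L2 w & weak_div u w.

Variable p : nat.

Definition raviart_thomas (u : bvector) :=
  Hdiv u /\
  forall k, exists2 uhat : point -> point,
    (forall m, tensor_poly (fun l => if l == m then p else p.-1)
                 (fun x => uhat x ord0 m))
    & forall x, unit_cube x ->
        u k (T k x) = (\det (jac k x))^-1 *: (uhat x *m jac k x).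

Definition Wh (w : bscalar) :=
  L2 w /\
  forall k, exists2 what : point -> R,
    tensor_poly (fun=> p.-1) what
    & forall x, unit_cube x -> w k (T k x) = (\det (jac k x))^-1 * what x.

Variable g : 'I_p.+1 -> R.

(* A box of the subdivided reference cube is given by the position of its
   interval along each axis. *)
Definition subbox := {ffun 'I_d -> 'I_p}.
Definition lo (c : subbox) : point := \row_l g (widen_ord (leqnSn p) (c l)).
Definition hi (c : subbox) : point := \row_l g (lift ord0 (c l)).

(* The (d-1)-dimensional face of c orthogonal to axis m: lower for e = false,
   upper for e = true. *)
Definition subface (c : subbox) (m : 'I_d) (e : bool) : set point :=
  box_face (lo c) (hi c) (fun l => if l == m then Some e else None).

Definition subelement_mesh :=
  conforming (fun i : K * subbox => T i.1) (fun i => lo i.2) (fun i => hi i.2).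

(* Area vector on T k (x_m = const): the vector product of the two tangent
   vectors for d = 3, the rotated tangent vector for d = 2. In usual notation it
   is det J J^-T e_m. *)
Definition area (k : K) (m : 'I_d) (x : point) : point :=
  (col m (\adj (jac k x)))^T.

(* [face] enumerates, without repetition, the faces of all subelements. *)
Definition face_numbering (M : nat) (face : 'I_M -> set point) :=
  injective face /\
  range face = [set F | exists k c m e, F = T k @` subface c m e].

(* [nu j] is a unit normal of face j, pointing to one and the same side of the
   face at all its points. *)
Definition face_normals (M : nat) (face : 'I_M -> set point)
    (nu : 'I_M -> point -> point) :=
  forall j k c m e, face j = T k @` subface c m e ->
    exists s : bool, forall x, subface c m e x ->
      nu j (T k x) = (-1) ^+ s *: ((enorm (area k m x))^-1 *: area k m x).

(* Surface integral over T k (subface c m e) of the component along n of the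
   trace of u from the element k. *)
Definition face_dof (k : K) (c : subbox) (m : 'I_d) (e : bool)
    (n : point -> point) (u : bvector) : R :=
  fine (iint [seq l <- enum 'I_d | l != m] (lo c) (hi c)
         (fun x => (dot (u k (T k x)) (n (T k x)) * enorm (area k m x))%:E)
         (if e then hi c else lo c)).

Definition volume_dof (i : K * subbox) (w : bscalar) : R :=
  fine (box_int (lo i.2) (hi i.2)
         (fun x => (w i.1 (T i.1 x) * \det (jac i.1 x))%:E)).

(* The normal component of a field of H(div) is single-valued on a face shared
   by two subelements, so duality is stated for the traces from both sides. *)
Definition Vh_basis (M : nat) (face : 'I_M -> set point)
    (nu : 'I_M -> point -> point) (phi : 'I_M -> bvector) :=
  [/\ forall j, raviart_thomas (phi j),
      forall u, raviart_thomas u -> exists a : 'I_M -> R,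
        forall k x, unit_cube x ->
          u k (T k x) = \sum_j a j *: phi j k (T k x)
    & forall j j' k c m e, face j' = T k @` subface c m e ->
        face_dof k c m e (nu j') (phi j) = (j == j')%:R].

Definition Wh_basis (N : nat) (cell : 'I_N -> K * subbox)
    (psi : 'I_N -> bscalar) :=
  [/\ forall i, Wh (psi i),
      forall w, Wh w -> exists a : 'I_N -> R,
        forall k x, unit_cube x ->
          w k (T k x) = \sum_i a i * psi i k (T k x)
    & forall i i', volume_dof (cell i') (psi i) = (i == i')%:R].

Definition mass_W (alpha : point -> R) (N : nat) (psi : 'I_N -> bscalar)
    : 'M[R]_N :=
  \matrix_(i, i') Omega_int (fun k y => alpha y * psi i' k y * psi i k y).

Definition mass_V (beta : point -> R) (M : nat) (phi : 'I_M -> bvector)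
    : 'M[R]_M :=
  \matrix_(j, j') Omega_int (fun k y => beta y * dot (phi j' k y) (phi j k y)).

(* D is the matrix of the divergence from the basis phi to the basis psi. *)
Definition divergence_matrix (N M : nat) (phi : 'I_M -> bvector)
    (psi : 'I_N -> bscalar) (D : 'M[R]_(N, M)) :=
  forall j, weak_div (phi j) (fun k y => \sum_i D i j * psi i k y).

End Mesh.

(* Main.v *)
Require Import Defs.
From mathcomp Require Import all_boot all_order all_algebra.
From mathcomp Require Import all_classical all_reals all_analysis.
From mathcomp Require Import ring lra.

Set Implicit Arguments.
Unset Strict Implicit.
Unset Printing Implicit Defensive.

Import Order.TTheory GRing.Theory Num.Theory.
Import numFieldNormedType.Exports.

Local Open Scope classical_set_scope.
Local Open Scope ring_scope.

(* An entry of D is the integral over a subelement of the divergence of a basis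
   field. Pulled back to the reference cube, the Piola transform makes the weak
   divergence a statement about tensor-product polynomials, and the test
   function T_* (b_1(x_1) ... b_d(x_d)), whose factors b_l have the same moments
   as the indicators of the sides of the subelement, yields the divergence
   theorem on that subelement. Hence D_ij is the signed sum of the face degrees
   of freedom of phi_j. Two distinct subelements with a common face have opposite
   outward normals there, since otherwise their interiors would meet; so
   D_ij D_i'j <= 0 for i <> i'. The approximate Schur complement is then a
   symmetric positive definite matrix with nonpositive off-diagonal entries, and
   such a matrix has a nonnegative inverse (Stieltjes). *)

(** * M-matrices *)

Section MMatrix.
Variables (R : realType) (n : nat).
Implicit Type A : 'M[R]_n.

Lemma posdef_diag_gt0 A i : posdef A -> 0 < A i i.
Proof.
move=> [_ /(_ (delta_mx i ord0))].
rewrite trmx_delta -rowE -colE !mxE; apply.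
by apply/eqP => /matrixP /(_ i ord0) /eqP; rewrite !mxE !eqxx oner_eq0.
Qed.

(** A nonzero vector in the left kernel would make the quadratic form vanish. *)
Lemma posdef_unitmx A : posdef A -> A \in unitmx.
Proof.
move=> [sA pA]; rewrite -row_free_unit -kermx_eq0; apply/rowV0P => v.
move/sub_kermxP => vA; apply/eqP; apply: contraT => v0.
have := pA v^T; rewrite trmx_eq0 => /(_ v0).
by rewrite trmxK vA mul0mx mxE ltxx.
Qed.

(* Test [A x = b >= 0] against the negative part [y] of [x]: the off-diagonal
   signs give [y^T A y <= y^T b <= 0], so [y = 0]. *)
Lemma posdef_is_M_matrix A :
  posdef A -> (forall i j, i != j -> A i j <= 0) -> is_M_matrix A.
Proof.
move=> pA offA; have uA := posdef_unitmx pA; split=> // i j.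
pose x := col j (invmx A).
have xE k : x k ord0 = invmx A k j by rewrite !mxE.
rewrite -xE.
have Ax : A *m x = delta_mx j ord0 by rewrite /x colE mulKVmx.
pose y : 'cV[R]_n := \col_k Num.min (x k ord0) 0.
have y0 k : y k ord0 <= 0 by rewrite mxE ge_min lexx orbT.
suff yz : y = 0.
  have /eqP := congr1 (fun z : 'cV_n => z i ord0) yz.
  by rewrite !mxE minEle; case: ifP => [_ /eqP ->|/negbT]; rewrite -?ltNge// => /ltW.
apply/eqP; apply: contraT => /(pA.2); apply: contraTT => _.
rewrite -leNgt.
(* With [A *m x] a unit vector, the first term is an entry of [y], hence nonpositive. The second
   term remains to be shown nonnegative, entry by entry. *)
have -> : y^T *m A *m y = y^T *m A *m x - y^T *m A *m (x - y).
  by rewrite mulmxBr opprB addrC subrK.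
rewrite -!mulmxA Ax mxE [X in _ + X]mxE subr_le0; apply: (@le_trans _ _ 0).
  by rewrite -colE mxE mxE y0.
rewrite mxE; apply: sumr_ge0 => k _; rewrite [(A *m _) _ _]mxE mulr_sumr.
apply: sumr_ge0 => l _.
have -> : (x - y) l ord0 = x l ord0 - Num.min (x l ord0) 0 by rewrite !mxE.
have -> : y^T ord0 k = Num.min (x k ord0) 0 by rewrite !mxE.
(* On the diagonal one of [y_k] and [(x - y)_k] is zero, being the negative and the positive part of
   the same number. Off the diagonal the three signs suffice. *)
have [<-|kl] := eqVneq k l.
  by rewrite minEle; case: ifP; rewrite ?subrr ?mulr0 ?mul0r.
rewrite mulr_le0// ?ge_min ?lexx ?orbT//.
by rewrite mulr_le0_ge0 ?offA// subr_ge0 ge_min lexx.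
Qed.

End MMatrix.

Lemma invmx_diag (F : fieldType) n (u : 'rV[F]_n) :
  (forall i, u ord0 i != 0) -> invmx (diag_mx u) = diag_mx (\row_i (u ord0 i)^-1).
Proof.
move=> u0; have uu : diag_mx u \in unitmx.
  by rewrite unitmxE det_diag unitfE; apply/prodf_neq0 => i _; apply: u0.
apply: (can_inj (mulKmx uu)); rewrite mulmxV// mulmx_diag -diag_const_mx.
by congr diag_mx; apply/rowP => i; rewrite !mxE divff.
Qed.

(** The entry [(i, i')] of the second summand is the sum over [j] of [D i j * D i' j / V j j], so
    the sign hypothesis controls the off-diagonal part. Definiteness comes from the first summand,
    the second being positive semidefinite. *)
Lemma schur_complement_is_M_matrix (R : realType) N M (W : 'M[R]_N)
    (V : 'M[R]_M) (D : 'M[R]_(N, M)) :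
  (forall i, 0 < W i i) -> (forall j, 0 < V j j) ->
  (forall i i' j, i != i' -> D i j * D i' j <= 0) ->
  is_M_matrix (invmx (diag_part W) + D *m invmx (diag_part V) *m D^T).
Proof.
move=> W0 V0 DD; rewrite !invmx_diag; first last.
- by move=> j; rewrite mxE gt_eqF.
- by move=> i; rewrite mxE gt_eqF.
set w := diag_mx _; set v := diag_mx _.
have DvE i i' : (D *m v *m D^T) i i' = \sum_j (V j j)^-1 * (D i j * D i' j).
  rewrite mxE; apply: eq_bigr => j _; rewrite mul_mx_diag !mxE.
  by rewrite -mulrA mulrCA.
apply: posdef_is_M_matrix; last first.
  move=> i i' ii'; rewrite mxE DvE !mxE (negbTE ii') mulr0n add0r.
  by apply: sumr_le0 => j _; rewrite mulr_ge0_le0 ?DD// invr_ge0 ltW.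
split.
  by rewrite linearD /= !trmx_mul trmxK !tr_diag_mx mulmxA.
move=> x x0; rewrite mulmxDr mulmxDl [X in 0 < X]mxE.
have qf m (u : 'rV[R]_m) (z : 'cV[R]_m) :
    (z^T *m diag_mx u *m z) ord0 ord0 = \sum_i u ord0 i * (z i ord0) ^+ 2.
  rewrite mxE; apply: eq_bigr => i _; rewrite mul_mx_diag !mxE expr2.
  by rewrite mulrAC mulrC.
rewrite ltr_wpDr//.
  have -> : x^T *m (D *m v *m D^T) *m x = (D^T *m x)^T *m v *m (D^T *m x).
    by rewrite trmx_mul trmxK !mulmxA.
  rewrite qf; apply: sumr_ge0 => i _.
  by rewrite mulr_ge0 ?sqr_ge0// !mxE invr_ge0 ltW.
rewrite qf; have [i xi] : exists i, x i ord0 != 0.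
  apply/existsP; apply: contraNT x0 => /existsPn h; apply/eqP/matrixP => i j.
  by rewrite ord1 mxE; apply/eqP; move: (h i); rewrite negbK.
rewrite (bigD1 i)//= ltr_pwDl//; last first.
  by apply: sumr_ge0 => k _; rewrite mulr_ge0 ?sqr_ge0// !mxE invr_ge0 ltW.
by rewrite mulr_gt0// ?exprn_even_gt0//= !mxE invr_gt0.
Qed.

(** * Iterated integrals of tensor products *)

Section IntervalIntegral.
Variable R : realType.
Implicit Types (a b : R) (f g : R -> R).

Definition integral_cc a b f : R := \int[lebesgue_measure]_(t in `[a, b]) f t.

Lemma integrable_itv a b f : continuous f ->
  lebesgue_measure.-integrable `[a, b] (EFin \o f).
Proof.
move=> cf; apply: continuous_compact_integrable; first exact: segment_compact.
exact: continuous_subspaceT.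
Qed.

Lemma EFin_integral_cc a b f : continuous f ->
  (\int[lebesgue_measure]_(t in `[a, b]) (f t)%:E)%E = (integral_cc a b f)%:E.
Proof.
move=> cf; rewrite /integral_cc /Rintegral fineK//.
by apply: integrable_fin_num => //; exact: integrable_itv.
Qed.

Lemma integral_sumZ a b (J : finType) (c : J -> R) (f : J -> R -> R) :
  (forall j, continuous (f j)) ->
  (\int[lebesgue_measure]_(t in `[a, b]) (\sum_j c j * f j t)%:E)%E =
  (\sum_j c j * integral_cc a b (f j))%:E.
Proof.
move=> cf; under eq_integral do rewrite -sumEFin.
rewrite integral_sum//; last first.
  by move=> j; apply: integrable_itv => t; apply: cvgM; [exact: cvg_cst|exact: cf].
rewrite -sumEFin; apply: eq_bigr => j _; under eq_integral do rewrite EFinM.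
by rewrite integralZl//; [rewrite EFin_integral_cc | exact: integrable_itv].
Qed.

Lemma integral_cc_sumZ a b (J : finType) (c : J -> R) (f : J -> R -> R) :
  (forall j, continuous (f j)) ->
  integral_cc a b (fun t => \sum_j c j * f j t) =
  \sum_j c j * integral_cc a b (f j).
Proof. by move=> cf; rewrite {1}/integral_cc /Rintegral integral_sumZ. Qed.

Lemma eq_integral_cc a b f g : (forall t, a <= t <= b -> f t = g t) ->
  integral_cc a b f = integral_cc a b g.
Proof.
by move=> fg; apply: eq_Rintegral => t; rewrite inE/= in_itv/=; exact: fg.
Qed.

Lemma integral_ccD a b f g : continuous f -> continuous g ->
  integral_cc a b (fun t => f t + g t) = integral_cc a b f + integral_cc a b g.
Proof. by move=> cf cg; rewrite /integral_cc RintegralD//; exact: integrable_itv. Qed.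

Lemma integral_ccZ a b k f : continuous f ->
  integral_cc a b (fun t => k * f t) = k * integral_cc a b f.
Proof. by move=> cf; rewrite /integral_cc RintegralZl//; exact: integrable_itv. Qed.

Lemma integral_cc_derive a b f (F : R -> R) : a < b -> continuous f ->
  (forall t : R, is_derive t 1 F (f t)) -> integral_cc a b f = F b - F a.
Proof.
move=> ab cf dF; have cF : continuous F.
  move=> t; apply/differentiable_continuous/derivable1_diffP.
  exact: ex_derive.
rewrite /integral_cc /Rintegral (@continuous_FTC2 _ f F)//.
- exact: continuous_subspaceT.
- split => [t _||]; [exact: ex_derive | |].
  + exact/cvg_at_right_filter/cF.
  + exact/cvg_at_left_filter/cF.
- by move=> t _; rewrite derive1E derive_val.
Qed.

End IntervalIntegral.

Section IteratedIntegral.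
Variables (R : realType) (d : nat).
Implicit Types (s : seq 'I_d) (a b x : 'rV[R]_d).

(** The iterated integral evaluates its integrand only at points whose listed coordinates lie in the
    box and whose other coordinates are those of [x]. Formulas valid only on a box or a face can
    thus be substituted under the integral. *)
Lemma eq_iint s a b f g x :
  (forall z : 'rV[R]_d,
     (forall l, if l \in s then a ord0 l <= z ord0 l <= b ord0 l
                else z ord0 l == x ord0 l) -> f z = g z) ->
  iint s a b f x = iint s a b g x.
Proof.
elim: s x => [|l s IH] x fg /=; first by apply: fg => l /=.
apply: eq_integral => t; rewrite inE/= in_itv/= => tab.
apply: IH => z zx; apply: fg => k; have := zx k; rewrite in_cons mxE.
by have [->|//] := eqVneq k l; case: ifP => // _ /eqP ->.
Qed.

(** Induction on the list of coordinates: each integration replaces one factor by its integral, and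
    the class of finite sums of products is preserved, so Fubini's theorem is not called upon. *)
Lemma iint_tensor s a b (J : finType) (c : J -> R) (F : J -> 'I_d -> R -> R) x :
  (forall j l, continuous (F j l)) -> uniq s ->
  iint s a b (fun z => (\sum_j c j * \prod_l F j l (z ord0 l))%:E) x =
  (\sum_j c j * \prod_l (if l \in s then integral_cc (a ord0 l) (b ord0 l) (F j l)
                         else F j l (x ord0 l)))%:E.
Proof.
move=> cF; elim: s x => [|l s IH] x //= /andP[ls us].
(* The factors other than [l], constant in the outermost integration variable. *)
pose P j := \prod_(k | k != l)
  (if k \in s then integral_cc (a ord0 k) (b ord0 k) (F j k) else F j k (x ord0 k)).
transitivity (\int[lebesgue_measure]_(t in `[a ord0 l, b ord0 l])
   (\sum_j (c j * P j) * F j l t)%:E)%E.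
  apply: eq_integral => t _; rewrite IH//; congr EFin.
  apply: eq_bigr => j _; rewrite -mulrA; congr (_ * _).
  rewrite (bigD1 l)//= (negbTE ls) mxE eqxx mulrC; congr (_ * _).
  by apply: eq_bigr => k kl; rewrite mxE (negbTE kl).
rewrite integral_sumZ//; congr EFin; apply: eq_bigr => j _.
rewrite -mulrA; congr (_ * _).
rewrite (bigD1 l)//= mem_head mulrC; congr (_ * _).
by apply: eq_bigr => k kl; rewrite in_cons (negbTE kl).
Qed.

End IteratedIntegral.

(** * Test functions *)

Section MomentBump.
Variable R : realType.
Implicit Types (t : R) (f : R -> R).

(** Squaring the positive part smooths its kink: at 0 the difference quotient is bounded by [|h|].
    This gives the bump its C^1 regularity. *)
Lemma is_derive_sqr_max0 t :
  is_derive t 1 (fun s : R => Num.max 0 s ^+ 2) (2 * Num.max 0 t).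
Proof.
have [t0|t0|<-] := ltgtP 0 t.
- apply: (@near_eq_is_derive _ _ _ (fun s : R => s ^+ 2)).
    near=> s; rewrite max_r// ltW//.
    near: s; exact: lt_nbhsr.
  have := is_deriveX 2 (is_derive_id t 1).
  by rewrite expr1 [_ *: 1]mulr1.
- apply: (@near_eq_is_derive _ _ _ (cst 0)).
    near=> s; rewrite max_l ?expr0n// ltW//.
    near: s; exact: lt_nbhsl.
  by apply: is_derive_eq; rewrite mulr0.
- rewrite mulr0.
  have h : (fun h : R => h^-1 *: (Num.max 0 (h *: 1 + 0 : R) ^+ 2 - Num.max 0 (0:R) ^+ 2))
     @ 0^' --> (0 : R).
    apply/cvgrPdist_le => e e0; near=> h.
    rewrite maxxx expr0n subr0 addr0 sub0r normrN [h *: 1]mulr1.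
    rewrite -[_ *: _]/(_ * _) normrM normrX normfV expr2 mulrA.
    have hn0 : h != 0 by near: h; exact: nbhs_dnbhs_neq.
    have hle : `|Num.max 0 h| <= `|h|.
      by case: (ltP 0 h) => //; rewrite normr0.
    have he : `|h| <= e by near: h; apply: dnbhs0_le.
    apply: le_trans he; rewrite -[leRHS]mul1r ler_pM//.
    by rewrite mulrC ler_pdivrMr ?mul1r// normr_gt0.
  apply: DeriveDef; first by apply/cvg_ex; exists 0.
  exact/cvg_lim.
Unshelve. all: by end_near. Qed.

(** The primitive from [a] is squeezed between 0 and the full integral, so it vanishes up to [b];
    its derivative is [f]. *)
Lemma integral_cc_eq0 a b f : continuous f -> (forall t, 0 <= f t) ->
  integral_cc a b f = 0 -> forall t, a < t < b -> f t = 0.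
Proof.
move=> cf f0 fab0 t /andP[at_ tb].
have [_ <-] := continuous_FTC1_closed tb (@integrable_itv _ a b f cf) at_ (cf t).
have F0 s : s < b -> integral_cc a s f = 0.
  move=> sb; apply/eqP; rewrite eq_le Rintegral_ge0// andbT -fab0.
  rewrite -lee_fin -!EFin_integral_cc//; apply: ge0_subset_integral => //=.
  - by have /integrableP[] := @integrable_itv _ a b f cf.
  - by move=> x _; rewrite lee_fin.
  - by move=> x /=; rewrite !in_itv/= => /andP[-> /le_trans]; apply; exact: ltW.
rewrite derive1E -(derive_cst (0 : R) t 1); apply: near_eq_derive.
near=> s; apply: F0; near: s; exact: lt_nbhsl.
Unshelve. all: by end_near. Qed.

Let q t : R := (t - 4^-1) * (3 / 4 - t).

(** Positive exactly between the roots 1/4 and 3/4 of [q], hence supported inside the unit interval,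
    and C^1 as [test_function] requires. *)
Definition bump t : R := Num.max 0 (q t) ^+ 2.

Let dbump t : R := 2 * Num.max 0 (q t) * (1 - 2 * t).

Lemma is_derive_bump t : is_derive t 1 bump (dbump t).
Proof.
apply: (@is_derive1_comp _ (fun s : R => Num.max 0 s ^+ 2) q).
  exact: is_derive_sqr_max0.
rewrite /q; apply: is_derive_eq; rewrite /= -![_ *: _]/(_ * _); by field.
Qed.

Lemma bump_gt0 t : 4^-1 < t < 3 / 4 -> 0 < bump t.
Proof.
move=> /andP[t1 t2]; rewrite exprn_even_gt0//= gt_eqF// lt_max mulr_gt0 ?orbT//.
  by rewrite subr_gt0.
by rewrite subr_gt0.
Qed.

Lemma bump_eq0 t : ~ (4^-1 <= t <= 3 / 4) -> bump t = 0.
Proof.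
move=> /negP; rewrite negb_and -!ltNge => t0.
rewrite /bump max_l ?expr0n// /q; case/orP: t0 => t0; nra.
Qed.

Lemma continuous_bump : continuous bump.
Proof.
move=> t; apply/differentiable_continuous/derivable1_diffP.
by have [] := is_derive_bump t.
Qed.

Lemma continuous_dbump : continuous dbump.
Proof.
have cq : continuous q.
  move=> t; rewrite /q; apply: cvgM; apply: cvgB => //; exact: cvg_cst.
move=> t; apply: cvgM; last first.
  apply: cvgB; first exact: cvg_cst.
  by apply: cvgM => //; exact: cvg_cst.
apply: cvgM; first exact: cvg_cst.
by apply: (@continuous_max _ _ (cst 0) q); [exact: cst_continuous | exact: cq].
Qed.

Lemma is_derive_horner (P : {poly R}) t :
  is_derive t 1 (horner P) (P^`()).[t].
Proof.
apply: DeriveDef; first exact: derivable_horner.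
by rewrite -derive1E -derivE.
Qed.

Lemma rVpoly_horner n (v : 'rV[R]_n) t : (rVpoly v).[t] = \sum_i v ord0 i * t ^+ i.
Proof. by rewrite /rVpoly horner_poly; apply: eq_bigr => i _; rewrite valK. Qed.

(** Gram matrix of the monomials of degree less than [n] for the inner product with weight
    [bump]. *)
Definition gram_bump n : 'M[R]_n :=
  \matrix_(i, j) integral_cc 0 1 (fun t => t ^+ i * (t ^+ j * bump t)).

Lemma row_gram_bump n (v : 'rV[R]_n) j :
  (v *m gram_bump n) ord0 j =
  integral_cc 0 1 (fun t => (rVpoly v).[t] * (t ^+ j * bump t)).
Proof.
rewrite mxE; under eq_bigr do rewrite mxE.
rewrite -(@integral_cc_sumZ R 0 1 _ (v ord0)
  (fun i t => t ^+ i * (t ^+ j * bump t))); last first.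
  move=> i t; apply: cvgM; first exact: exprn_continuous.
  by apply: cvgM; [exact: exprn_continuous | exact: continuous_bump].
apply: eq_integral_cc => t _.
rewrite rVpoly_horner mulr_suml; by apply: eq_bigr => i _; rewrite mulrA.
Qed.

(** A kernel vector is the coefficient vector of a polynomial [P] for which the integral of
    [P^2 * bump] is zero. Then [P] vanishes on ]1/4, 3/4[, which gives more roots than its degree
    allows. *)
Lemma gram_bump_unit n : gram_bump n \in unitmx.
Proof.
rewrite -row_free_unit -kermx_eq0; apply/rowV0P => v /sub_kermxP vG.
pose P := rVpoly v.
have cP : continuous (horner P) by exact: continuous_horner.
have cF : continuous (fun t => P.[t] ^+ 2 * bump t).
  by move=> t; apply: cvgM; [apply: cvgM; exact: cP | exact: continuous_bump].
have I0 : integral_cc 0 1 (fun t => P.[t] ^+ 2 * bump t) = 0.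
  transitivity (\sum_j v ord0 j * (v *m gram_bump n) ord0 j); last first.
    by rewrite vG big1// => j _; rewrite mxE mulr0.
  under eq_bigr do rewrite row_gram_bump.
  rewrite -(@integral_cc_sumZ R 0 1 _ (v ord0)
    (fun j t => P.[t] * (t ^+ j * bump t))); last first.
    move=> i t; apply: cvgM; first exact: cP.
    by apply: cvgM; [exact: exprn_continuous | exact: continuous_bump].
  apply: eq_integral_cc => t _; rewrite expr2 -mulrA {1}/P rVpoly_horner mulr_suml.
  by apply: eq_bigr => j _; rewrite -mulrA; congr (_ * _); rewrite mulrCA.
have rP t : 4^-1 < t < 3 / 4 -> root P t.
  move=> t01; have := integral_cc_eq0 cF _ I0 (t := t).
  move=> /(_ _ _)/eqP; rewrite mulf_eq0 (gt_eqF (bump_gt0 t01)) orbF sqrf_eq0.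
  apply; last by move: t01; lra.
  by move=> s; rewrite mulr_ge0// ?sqr_ge0//.
suff P0 : P = 0 by rewrite -[v]rVpolyK -/P P0 linear0.
(* These are [n] distinct points; the offset from 1/4 is at most 1/3, below the length 1/2 of the
   interval. *)
apply: (@roots_geq_poly_eq0 _ _ [seq 4^-1 + (3 + i%:R)^-1 | i <- iota 0 n]).
- apply/allP => _ /mapP[i _ ->]; apply: rP.
  rewrite ltrDl invr_gt0 ltr_wpDr ?ler0n//=.
  have : (3 + i%:R)^-1 <= 3^-1 :> R by rewrite lef_pV2 ?posrE ?ltr_wpDr ?ler0n// lerDl.
  lra.
- rewrite map_inj_uniq ?iota_uniq// => i j /addrI/invr_inj/addrI/eqP.
  by rewrite eqr_nat => /eqP.
- by rewrite size_map size_iota size_poly.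
Qed.

(** For a polynomial multiple of [bump], prescribing the moments is a linear system in the
    coefficients, whose matrix is the invertible [gram_bump n]. *)
Lemma exists_moment_bump n (mom : 'I_n -> R) : exists b b' : R -> R,
  [/\ forall t, is_derive t 1 b (b' t), continuous b',
      forall t, ~ (4^-1 <= t <= 3 / 4) -> b t = 0
    & forall j : 'I_n, integral_cc 0 1 (fun t => t ^+ j * b t) = mom j].
Proof.
pose P := rVpoly ((\row_j mom j) *m invmx (gram_bump n)).
have cH (Q : {poly R}) : continuous (horner Q) by exact: continuous_horner.
exists (fun t => P.[t] * bump t), (fun t => P^`().[t] * bump t + P.[t] * dbump t).
split=> [t|t|t t0|j].
- have := is_deriveM (is_derive_horner P t) (is_derive_bump t).
  by rewrite [P^`().[t] * _]mulrC [X in _ -> is_derive _ _ _ X]addrC.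
- apply: cvgD.
    by apply: cvgM; [exact: cH | exact: continuous_bump].
  by apply: cvgM; [exact: cH | exact: continuous_dbump].
- by rewrite bump_eq0// mulr0.
- transitivity (((\row_j mom j) *m invmx (gram_bump n) *m gram_bump n) ord0 j).
    by rewrite row_gram_bump; apply: eq_integral_cc => t _; rewrite mulrCA.
  by rewrite mulmxKV ?gram_bump_unit// mxE.
Qed.

Lemma is_derive_expr n t : is_derive t 1 (fun s : R => s ^+ n) (n%:R * t ^+ n.-1).
Proof.
apply: DeriveDef; first exact: exprn_derivable.
by rewrite exp_derive [_ *: 1]mulr1.
Qed.

Lemma integral_cc_expr n a b : a < b ->
  integral_cc a b (fun t => n%:R * t ^+ n.-1) = b ^+ n - a ^+ n.
Proof.
move=> ab; apply: (@integral_cc_derive _ a b _ (fun s => s ^+ n)) => //.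
  by move=> t; apply: cvgM; [exact: cvg_cst | exact: exprn_continuous].
exact: is_derive_expr.
Qed.

(* Against polynomials of degree at most [n], the C^1 function [b.1] integrates
   exactly as the indicator of [[lo, hi]] does, and [b.2] as its distributional
   derivative. *)
Lemma exists_indicator_bump n lo hi : lo < hi -> exists b : (R -> R) * (R -> R),
  [/\ forall t, is_derive t 1 b.1 (b.2 t), continuous b.2,
      forall t, ~ (4^-1 <= t <= 3 / 4) -> b.1 t = 0,
      forall j, (j <= n)%N -> integral_cc 0 1 (fun t => t ^+ j * b.1 t) =
                              integral_cc lo hi (fun t => t ^+ j)
    & forall j, (j <= n)%N -> integral_cc 0 1 (fun t => t ^+ j * b.2 t) =
                              - (hi ^+ j - lo ^+ j)].
Proof.
move=> lohi.
have [b [b' [db cb' b0 bm]]] := @exists_moment_bump n.+1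
  (fun j => integral_cc lo hi (fun t => t ^+ j)).
exists (b, b'); split=> //= [j jn|j jn]; first exact: (bm (Ordinal (jn : j < n.+1)%N)).
have cb : continuous b.
  move=> t; apply/differentiable_continuous/derivable1_diffP.
  by have [] := db t.
have cD : continuous (fun t => (j%:R * t ^+ j.-1) * b t).
  move=> t; apply: cvgM; last exact: cb.
  by apply: cvgM; [exact: cvg_cst | exact: exprn_continuous].
have cE : continuous (fun t => t ^+ j * b' t).
  by move=> t; apply: cvgM; [exact: exprn_continuous | exact: cb'].
(* Integration by parts: the two integrals add up to that of the derivative of [t ^+ j * b t], and
   [b] vanishes at 0 and 1. For [j = 0] the truncated predecessor is harmless, since its term
   carries the factor [j%:R]. *)
apply/eqP; rewrite -addr_eq0 addrC -(integral_cc_expr j lohi).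
have -> : integral_cc lo hi (fun t => j%:R * t ^+ j.-1) =
          integral_cc 0 1 (fun t => (j%:R * t ^+ j.-1) * b t).
  rewrite integral_ccZ; last exact: exprn_continuous.
  rewrite -(bm (Ordinal (leq_ltn_trans (leq_pred j) (jn : j < n.+1)%N))) /=.
  rewrite -integral_ccZ; last first.
    by move=> t; apply: cvgM; [exact: exprn_continuous | exact: cb].
  by apply: eq_integral_cc => t _; rewrite mulrA.
rewrite -integral_ccD//.
have dF t : is_derive t 1 (fun t => t ^+ j * b t)
    (j%:R * t ^+ j.-1 * b t + t ^+ j * b' t).
  have := is_deriveM (is_derive_expr j t) (db t).
  by rewrite [X in is_derive _ _ _ X -> _]addrC [X in X + _]mulrC.
rewrite (integral_cc_derive _ _ dF) ?ltr01//; last first.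
  by move=> t; apply: cvgD; [exact: cD | exact: cE].
by rewrite !b0 ?mulr0 ?subrr//; lra.
Qed.

End MomentBump.

(** * Locality of differentiability and continuity *)

Section LocalDifferentiability.
Variables (R : realType) (V W : normedModType R).

Lemma near_eq_differentiable (f g : V -> W) (x : V) :
  {near x, f =1 g} -> differentiable f x -> differentiable g x.
Proof.
move=> fg /diff_locallyP[cdf dxf].
have dxg : g \o shift x = cst (g x) + 'd f x +o_ 0 id.
  apply/eqaddoP => e e0; have /eqaddoP/(_ e e0) := dxf.
  have fgx : f x = g x by exact: nbhs_singleton fg.
  have fg0 : \forall h \near (0 : V), f (h + x) = g (h + x).
    by have := fg; rewrite (near_shift 0 x); apply: filterS => h; rewrite /= subr0.
  apply: filterS2 fg0 => h /= fgh.
  by rewrite !fctE /= fgh fgx.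
by apply/diff_locallyP; rewrite (diff_unique cdf dxg).
Qed.

End LocalDifferentiability.

Lemma near_eq_continuous_at (T U : topologicalType) (f g : T -> U) (x : T) :
  {near x, f =1 g} -> {for x, continuous f} -> {for x, continuous g}.
Proof.
move=> fg cf; rewrite /prop_for /continuous_at -(nbhs_singleton fg).
by apply: cvg_trans cf; exact: near_eq_cvg.
Qed.

(** * Tensor products of functions of one variable *)

Section TensorBump.
Variables (R : realType) (d : nat) (b b' : 'I_d -> R -> R).
Hypothesis db : forall l (t : R), is_derive t 1 (b l) (b' l t).
Hypothesis cb' : forall l, continuous (b' l).

Definition tensor_prod (x : 'rV[R]_d) := \prod_l b l (x ord0 l).

Definition tensor_partial (m : 'I_d) (x : 'rV[R]_d) :=
  \prod_l (if l == m then b' l else b l) (x ord0 l).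

Lemma differentiable_tensor_prod x : differentiable tensor_prod x.
Proof.
rewrite /tensor_prod; elim: (index_enum _) => [|l s IH].
  by under eq_fun do rewrite big_nil; exact: differentiable_cst.
under eq_fun do rewrite big_cons; apply: differentiableM => //.
apply: (@differentiable_comp _ _ _ _ (fun x : 'rV[R]_d => x ord0 l) (b l)).
  exact: differentiable_coord.
by apply/derivable1_diffP; exact: ex_derive.
Qed.

Lemma tensor_partialE m x :
  tensor_partial m x = b' m (x ord0 m) * \prod_(l | l != m) b l (x ord0 l).
Proof.
rewrite /tensor_partial (bigD1 m)//= eqxx; congr (_ * _).
by apply: eq_bigr => l /negbTE ->.
Qed.

Lemma derive_tensor_prod m x :
  'D_(delta_mx ord0 m) tensor_prod x = tensor_partial m x.
Proof.
set Q := \prod_(l | l != m) b l (x ord0 l).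
have dQ : is_derive (x ord0 m) 1 (fun t => Q * b m t) (Q * b' m (x ord0 m)).
  exact: is_deriveZ.
rewrite tensor_partialE mulrC -/Q -[RHS]derive_val /derive.
congr (lim (_ @ 0^')); apply/funext => h /=; congr (_ *: (_ - _)).
  rewrite /tensor_prod (bigD1 m)//= mulrC !mxE !eqxx; congr (_ * _).
  by apply: eq_bigr => l lm; rewrite !mxE (negbTE lm) mulr0 add0r.
by rewrite /tensor_prod (bigD1 m)//= mulrC.
Qed.

Lemma derive_sum_partial (f : 'rV[R]_d -> R) v x : differentiable f x ->
  'D_v f x = \sum_m v ord0 m * 'D_(delta_mx ord0 m) f x.
Proof.
move=> df; rewrite deriveE// {1}(row_sum_delta v) linear_sum.
by apply: eq_bigr => m _; rewrite linearZ deriveE.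
Qed.

Lemma continuous_tensor_partial m : continuous (tensor_partial m).
Proof.
have cb l : continuous (b l).
  move=> t; apply/differentiable_continuous/derivable1_diffP.
  exact: ex_derive.
apply: continuous_big; first exact: mul_continuous.
move=> l _ x.
apply: (@continuous_comp _ _ _ (fun x : 'rV[R]_d => x ord0 l)
  (if l == m then b' l else b l)).
  exact: coord_continuous.
by case: ifP => _; [exact: cb' | exact: cb].
Qed.

End TensorBump.

(** * Transport of test functions by a diffeomorphism *)

Section PushForward.
Variables (R : realType) (d : nat).
Implicit Types (U V Q : set 'rV[R]_d) (F G : 'rV[R]_d -> 'rV[R]_d).

Lemma continuous_at_sum (T : topologicalType) (I : finType) (f : I -> T -> R) x :
  (forall i, {for x, continuous (f i)}) ->
  {for x, continuous (fun y => \sum_i f i y)}.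
Proof.
move=> cf; rewrite /prop_for /continuous_at.
elim: (index_enum _) => [|i s IH].
  by under eq_fun do rewrite big_nil; rewrite big_nil; exact: cst_continuous.
by under eq_fun do rewrite big_cons; rewrite big_cons; exact: continuousD.
Qed.

Lemma C1_on_tensor_prod (b b' : 'I_d -> R -> R) :
  (forall l (t : R), is_derive t 1 (b l) (b' l t)) ->
  (forall l, continuous (b' l)) -> C1_on [set: 'rV[R]_d] (tensor_prod b).
Proof.
move=> db cb'; split=> [x _|v x _]; first exact: differentiable_tensor_prod db x.
have -> : 'D_v (tensor_prod b) = fun x => \sum_m v ord0 m * tensor_partial b b' m x.
  apply/funext => y; rewrite derive_sum_partial; last first.
    exact: differentiable_tensor_prod db y.
  by apply: eq_bigr => m _; rewrite (derive_tensor_prod db).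
move: x; apply: continuous_big; first exact: add_continuous.
move=> m _ x.
apply: (@continuousM _ _ (cst (v ord0 m)) (tensor_partial b b' m)).
  exact: cst_continuous.
exact: continuous_tensor_partial db cb' _ _.
Qed.

(** On [V] the chain rule writes each directional derivative of [f \o G] as a finite sum of products
    of continuous functions. *)
Lemma C1_on_comp V G (f : 'rV[R]_d -> R) :
  open V -> C1_on V G -> C1_on [set: 'rV[R]_d] f -> C1_on V (f \o G).
Proof.
move=> oV [dG cG] [df cf]; split=> [x Vx|v x Vx].
  by apply: differentiable_comp; [exact: dG | exact: df].
apply: (@near_eq_continuous_at _ _
  (fun y => \sum_m ('D_v G y) ord0 m * 'D_(delta_mx ord0 m) f (G y))).
  near=> y; have Vy : V y by near: y; exact: open_nbhs_nbhs.
  have dGy : differentiable G y by exact: dG.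
  have dfGy : differentiable f (G y) by exact: df.
  rewrite [RHS]deriveE; last exact: differentiable_comp.
  by rewrite diff_comp// /= -deriveE// derive_sum_partial// deriveE.
apply: continuous_at_sum => m.
apply: (@continuousM _ _ (fun y => ('D_v G y) ord0 m)
  (fun y => 'D_(delta_mx ord0 m) f (G y))).
  apply: (@continuous_comp _ _ _ ('D_v G) (fun z : 'rV[R]_d => z ord0 m)).
    exact: cG.
  exact: coord_continuous.
apply: (@continuous_comp _ _ _ G ('D_(delta_mx ord0 m) f)).
  by apply: differentiable_continuous; exact: dG.
exact: cf.
Unshelve. all: by end_near. Qed.

Lemma C1_on_eq (W : normedModType R) V (f g : 'rV[R]_d -> W) :
  open V -> (forall y, V y -> f y = g y) -> C1_on V f -> C1_on V g.
Proof.
move=> oV fg [df cf].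
have fgn y : V y -> {near y, f =1 g}.
  by move=> Vy; near=> z; apply: fg; near: z; exact: open_nbhs_nbhs.
split=> [x Vx|v x Vx].
  by apply: near_eq_differentiable (df _ Vx); exact: fgn.
apply: near_eq_continuous_at (cf v x Vx).
near=> z; apply: near_eq_derive; apply: fgn; near: z; exact: open_nbhs_nbhs.
Unshelve. all: by end_near. Qed.

Lemma C1_on_cst0 V : C1_on V (fun _ : 'rV[R]_d => 0 : R).
Proof.
split=> [x _|v x _]; first exact: differentiable_cst.
have -> : 'D_v (fun _ : 'rV[R]_d => 0 : R) = cst 0.
  by apply/funext => y; exact: derive_cst.
exact: cst_continuous.
Qed.

Definition push_forward F U G (f : 'rV[R]_d -> R) (y : 'rV[R]_d) : R :=
  if `[< (F @` U) y >] then f (G y) else 0.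

Section Properties.
Variables (F G : 'rV[R]_d -> 'rV[R]_d) (U Q : set 'rV[R]_d) (f : 'rV[R]_d -> R).
Hypothesis FK : forall x, U x -> G (F x) = x.
Hypothesis QU : Q `<=` U.
Hypothesis fQ : forall x, ~ Q x -> f x = 0.

Lemma push_forwardE x : U x -> push_forward F U G f (F x) = f x.
Proof. by move=> Ux; rewrite /push_forward asboolT ?FK//; exists x. Qed.

Lemma push_forward_eq0 y : ~ (F @` Q) y -> push_forward F U G f y = 0.
Proof.
move=> Qy; rewrite /push_forward; case: asboolP => // -[x Ux xy].
by rewrite -xy FK// fQ// => Qx; apply: Qy; exists x.
Qed.

Hypotheses (oU : open U) (oFU : open (F @` U)).
Hypotheses (C1F : C1_on U F) (C1G : C1_on (F @` U) G).
Hypothesis C1f : C1_on [set: 'rV[R]_d] f.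
Hypothesis cQ : compact Q.

Lemma compact_push : compact (F @` Q).
Proof.
apply: continuous_compact cQ; apply: continuous_in_subspaceT => x.
by rewrite inE => /QU Ux; apply: differentiable_continuous; exact: C1F.1.
Qed.

Lemma open_push_compl : open (~` (F @` Q)).
Proof.
by apply: closed_openC; apply: (compact_closed _ compact_push); exact: norm_hausdorff.
Qed.

(** Two open sets cover the space: [F @] U[, where the function is]f \o
    G[, and the complement of the compact set]F @[Q], where it is zero. *)
Lemma C1_push_forward : C1_on [set: 'rV[R]_d] (push_forward F U G f).
Proof.
have C1 : C1_on (F @` U) (push_forward F U G f).
  apply: C1_on_eq (C1_on_comp oFU C1G C1f) => // y Uy.
  by rewrite /push_forward asboolT.
have C2 : C1_on (~` (F @` Q)) (push_forward F U G f).
  apply: (C1_on_eq _ _ (C1_on_cst0 _)); first exact: open_push_compl.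
  by move=> y Qy; rewrite push_forward_eq0.
have UQ y : (F @` U) y \/ (~` (F @` Q)) y.
  have [[x Qx <-]|] := pselect ((F @` Q) y); last by right.
  by left; exists x => //; exact: QU.
split=> [y _|v y _]; case: (UQ y) => Hy; try exact: C1.1; try exact: C2.1.
- exact: C1.2.
- exact: C2.2.
Qed.

Lemma push_forward_test_function (Omega : set 'rV[R]_d) :
  F @` Q `<=` Omega -> test_function Omega (push_forward F U G f).
Proof.
move=> QO; split; first exact: C1_push_forward.
exists (F @` Q); split=> //; first exact: compact_push.
exact: push_forward_eq0.
Qed.

Lemma derive_push_forward_eq0 v y : ~ (F @` Q) y ->
  'D_v (push_forward F U G f) y = 0.
Proof.
move=> Qy; rewrite -(derive_cst (0 : R) y v); apply: near_eq_derive.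
near=> z; apply: push_forward_eq0; near: z.
by apply: open_nbhs_nbhs; split; [exact: open_push_compl | exact: Qy].
Unshelve. all: by end_near. Qed.

(** Chain rule for [f], which near [x] is the push-forward composed with [F]. The row convention of
    [jacobian] puts the direction [m] first. *)
Lemma derive_push_forward m x : U x ->
  'D_(delta_mx ord0 m) f x =
  \sum_l jacobian F x m l * 'D_(delta_mx ord0 l) (push_forward F U G f) (F x).
Proof.
move=> Ux.
have dF : differentiable F x by exact: C1F.1.
have dh : differentiable (push_forward F U G f) (F x) by exact: C1_push_forward.1.
transitivity ('D_(delta_mx ord0 m) (push_forward F U G f \o F) x).
  apply: near_eq_derive; near=> z; apply/esym/push_forwardE; near: z.
  exact: open_nbhs_nbhs.
rewrite deriveE; last exact: differentiable_comp.
rewrite diff_comp// /= -deriveE// derive_sum_partial//; apply: eq_bigr => l _.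
by rewrite -deriveE// deriveEjacobian// -rowE mxE.
Unshelve. all: by end_near. Qed.

End Properties.
End PushForward.

(** * The divergence theorem on a subelement *)

Section BoxGeometry.
Variables (R : realType) (d : nat).

Lemma nbhs_box (a b x : 'rV[R]_d) :
  (forall l, a ord0 l < x ord0 l < b ord0 l) -> nbhs x (box a b).
Proof.
move=> axb.
apply: (@filter_forall _ _
  (fun l (z : 'rV[R]_d) => is_true (a ord0 l <= z ord0 l <= b ord0 l)) (nbhs x)) => l.
have /andP[al bl] := axb l.
have cl := @coord_continuous R 1 d ord0 l x.
have tab : nbhs (x ord0 l) [set t | a ord0 l < t < b ord0 l].
  near=> t; apply/andP; split; near: t; [exact: lt_nbhsr | exact: lt_nbhsl].
have := cl _ tab; apply: (@filterS _ (nbhs x)) => z /= /andP[? ?].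
by apply/andP; split; apply: ltW.
Unshelve. all: by end_near. Qed.

Lemma nbhs_image (U A : set 'rV[R]_d) (F G : 'rV[R]_d -> 'rV[R]_d) x :
  (forall x, U x -> G (F x) = x) -> open (F @` U) -> {for F x, continuous G} ->
  U x -> nbhs x A -> nbhs (F x) (F @` A).
Proof.
move=> FK oFU cG Ux Ax.
have GA : nbhs (F x) (G @^-1` A) by apply: cG; rewrite FK.
have nU : nbhs (F x) (F @` U) by apply: open_nbhs_nbhs; split => //; exists x.
by apply: filterS2 nU GA => _ [z Uz <-]; rewrite /= FK// => Az; exists z.
Qed.

(** The index type [J i] varies with [i] because the components of a Raviart-Thomas field have
    different degrees in each variable; the double sum is flattened over a sigma type. *)
Lemma iint_tensor_dep (s : seq 'I_d) (a b x : 'rV[R]_d) (I : finType)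
    (J : I -> finType) (c : forall i, J i -> R)
    (F : forall i, J i -> 'I_d -> R -> R) :
  (forall i j l, continuous (F i j l)) -> uniq s ->
  iint s a b (fun z => (\sum_i \sum_j c i j * \prod_l F i j l (z ord0 l))%:E) x =
  (\sum_i \sum_j c i j *
     \prod_l (if l \in s then integral_cc (a ord0 l) (b ord0 l) (F i j l)
              else F i j l (x ord0 l)))%:E.
Proof.
move=> cF us; rewrite sig_big_dep /=.
under [in LHS]eq_fun do rewrite sig_big_dep /=.
exact: (@iint_tensor _ _ s a b {i & J i} (fun u => c (tag u) (tagged u))
  (fun u => F (tag u) (tagged u))).
Qed.

End BoxGeometry.

(** * The Piola transform and the degrees of freedom on the reference cube *)

Section ReferenceElement.
Variables (R : realType) (d p : nat) (K : finType) (T : K -> 'rV[R]_d -> 'rV[R]_d).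
Variable g : 'I_p.+1 -> R.
Hypothesis hg : gauss_lobatto g.
Hypothesis detT : forall k (x : 'rV[R]_d), unit_cube x -> 0 < \det (jac T k x).

Lemma subbox_bounds (c : subbox d p) l :
  [/\ 0 <= lo g c ord0 l, lo g c ord0 l < hi g c ord0 l & hi g c ord0 l <= 1].
Proof.
case: hg => gm g0 g1 _.
have gle (i j : 'I_p.+1) : (i <= j)%N -> g i <= g j.
  rewrite leq_eqVlt => /orP[/eqP/val_inj ->//|/gm/ltW //].
rewrite !mxE -g0 -g1; split; [exact: gle | apply: gm | apply: gle].
  by rewrite lift0 /=.
by rewrite lift0 /= ltn_ord.
Qed.

Lemma lo_lt_hi (c : subbox d p) l : lo g c ord0 l < hi g c ord0 l.
Proof. by case: (subbox_bounds c l). Qed.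

Lemma in_unit_cube (c : subbox d p) (x : 'rV[R]_d) :
  (forall l, lo g c ord0 l <= x ord0 l <= hi g c ord0 l) -> unit_cube x.
Proof.
move=> cx l; have [l0 _ h1] := subbox_bounds c l; have /andP[lx xh] := cx l.
by rewrite !mxE (le_trans l0 lx) (le_trans xh h1).
Qed.

Lemma subface_unit_cube (c : subbox d p) m e x :
  subface g c m e x -> unit_cube x.
Proof. by move=> [cx _]; exact: in_unit_cube cx. Qed.

Lemma dotZl (a b : 'rV[R]_d) (r : R) : dot (r *: a) b = r * dot a b.
Proof.
by rewrite /dot mulr_sumr; apply: eq_bigr => l _; rewrite mxE mulrA.
Qed.

Lemma dotZr (a b : 'rV[R]_d) (r : R) : dot a (r *: b) = r * dot a b.
Proof.
by rewrite /dot mulr_sumr; apply: eq_bigr => l _; rewrite mxE mulrCA.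
Qed.

Lemma det_jac_neq0 k x : unit_cube x -> \det (jac T k x) != 0.
Proof. by move=> /(detT k); exact: lt0r_neq0. Qed.

(** Since a matrix times its adjugate is its determinant times the identity, the Piola scaling
    cancels the area weight and leaves the reference component. *)
Lemma dot_area k m (v x : 'rV[R]_d) : unit_cube x ->
  dot ((\det (jac T k x))^-1 *: (v *m jac T k x)) (area T k m x) = v ord0 m.
Proof.
move=> cx; have -> (a b : 'rV[R]_d) : dot a b = (a *m b^T) ord0 ord0.
  by rewrite mxE; apply: eq_bigr => l _; rewrite mxE.
rewrite trmxK colE -scalemxAl mulmxA -(mulmxA v) mul_mx_adj mul_mx_scalar.
by rewrite -scalemxAl scalerA mulVf ?det_jac_neq0// scale1r -colE mxE.
Qed.

(** By [dot_area] the area vector has product 1 with the Piola image of the m-th unit vector. *)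
Lemma enorm_area_neq0 k m x : unit_cube x -> enorm (area T k m x) != 0.
Proof.
move=> cx; rewrite /enorm sqrtr_eq0 -ltNge lt_def.
have dot_ge0 (v : 'rV[R]_d) : 0 <= dot v v.
  by apply: sumr_ge0 => l _; rewrite -expr2 sqr_ge0.
rewrite dot_ge0 andbT; apply/eqP => a0.
have av l : area T k m x ord0 l = 0.
  apply/eqP; rewrite -sqrf_eq0 expr2; apply/eqP.
  move/eqP: a0; rewrite /dot psumr_eq0 => [|i _]; last by rewrite -expr2 sqr_ge0.
  by move=> /allP /(_ l); rewrite mem_index_enum => /(_ isT) /eqP.
have := dot_area k m (delta_mx ord0 m) cx.
rewrite mxE !eqxx /dot big1; last by move=> l _; rewrite av mulr0.
by move=> /eqP; rewrite eq_sym oner_eq0.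
Qed.

Lemma enorm_area_gt0 k m (x : 'rV[R]_d) : unit_cube x -> 0 < enorm (area T k m x).
Proof.
move=> cx; have := enorm_area_neq0 k m cx; rewrite /enorm.
by move: (dot _ _) => r r0; rewrite lt0r r0 sqrtr_ge0.
Qed.

(** Up to the positive factor [det J / |area|] and the sign of the normal, the normal component of a
    physical displacement is the m-th component of its reference direction. *)
Lemma dot_normal k m (x w v n : 'rV[R]_d) (s : bool) : unit_cube x ->
  v = w *m jac T k x ->
  n = (-1) ^+ s *: ((enorm (area T k m x))^-1 *: area T k m x) ->
  exists2 r, 0 < r & dot v n = (-1) ^+ s * (r * w ord0 m).
Proof.
move=> cx vE nE; have e0 := enorm_area_gt0 k m cx; have d0 := detT k cx.
have := dot_area k m w cx; rewrite dotZl -vE.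
rewrite nE; move: e0 d0; move: (area _ _ _ _) (\det _) => a D e0 D0 aw.
exists ((enorm a)^-1 * D); first by rewrite mulr_gt0 ?invr_gt0.
rewrite !dotZr -aw; congr (_ * _); rewrite mulrA -[_ * _ / D]mulrA mulfV ?gt_eqF//.
by rewrite mulr1.
Qed.

(** Flux towards increasing reference coordinate [m]; unlike [face_dof] it involves no chosen
    normal. *)
Definition flux (k : K) (c : subbox d p) (m : 'I_d) (e : bool)
    (u : bvector R d K) : R :=
  fine (iint [seq l <- enum 'I_d | l != m] (lo g c) (hi g c)
          (fun x => (dot (u k (T k x)) (area T k m x))%:E)
          (if e then hi g c else lo g c)).

Lemma iint_subface (c : subbox d p) m e f f' :
  (forall x, subface g c m e x -> f x = f' x) ->
  iint [seq l <- enum 'I_d | l != m] (lo g c) (hi g c) f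
       (if e then hi g c else lo g c) =
  iint [seq l <- enum 'I_d | l != m] (lo g c) (hi g c) f'
       (if e then hi g c else lo g c).
Proof.
move=> ff'; apply: eq_iint => z zc; apply: ff'.
have zm : z ord0 m = (if e then hi g c else lo g c) ord0 m.
  by apply/eqP; have := zc m; rewrite mem_filter eqxx.
split; last first.
  by move=> l s; have [->|//] := eqVneq l m; move=> [<-].
move=> l; have [->|lm] := eqVneq l m.
  have /ltW lh := lo_lt_hi c m.
  by rewrite zm; case: (e); rewrite lh lexx.
by have := zc l; rewrite mem_filter lm mem_enum.
Qed.

Section PiolaPolynomial.
Variables (k : K) (u : bvector R d K) (uhat : 'rV[R]_d -> 'rV[R]_d).
Variables (J : 'I_d -> finType) (cu : forall m, J m -> R).
Variable n : forall m, J m -> 'I_d -> nat.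
Hypothesis uhatE : forall m x,
  uhat x ord0 m = \sum_(j : J m) cu j * \prod_l x ord0 l ^+ n j l.
Hypothesis uE : forall x, unit_cube x ->
  u k (T k x) = (\det (jac T k x))^-1 *: (uhat x *m jac T k x).

Lemma fluxE c m e :
  flux k c m e u = \sum_(j : J m) cu j * \prod_l
    (if l != m then integral_cc (lo g c ord0 l) (hi g c ord0 l) (fun t => t ^+ n j l)
     else (if e then hi g c else lo g c) ord0 l ^+ n j l).
Proof.
rewrite /flux (@iint_subface c m e _
  (fun x => (\sum_(j : J m) cu j * \prod_l x ord0 l ^+ n j l)%:E)); last first.
  move=> x xc; rewrite uE; last exact: subface_unit_cube xc.
  by rewrite dot_area; [rewrite uhatE | exact: subface_unit_cube xc].
rewrite (@iint_tensor _ _ _ _ _ _ (@cu m) (fun (j : J m) l t => t ^+ n j l)).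
- by apply: eq_bigr => j _; congr (_ * _); apply: eq_bigr => l _;
    rewrite mem_filter mem_enum andbT.
- by move=> j l; exact: exprn_continuous.
- by rewrite filter_uniq// enum_uniq.
Qed.

(** The normalisation of the unit normal cancels the surface element [enorm (area T k m x)], so only
    the sign remains. *)
Lemma face_dof_flux c m e (nu : 'rV[R]_d -> 'rV[R]_d) (s : bool) :
  (forall x, subface g c m e x ->
     nu (T k x) = (-1) ^+ s *: ((enorm (area T k m x))^-1 *: area T k m x)) ->
  face_dof T g k c m e nu u = (-1) ^+ s * flux k c m e u.
Proof.
move=> nuE; rewrite fluxE /face_dof (@iint_subface c m e _
  (fun x => (\sum_(j : J m) ((-1) ^+ s * cu j) * \prod_l x ord0 l ^+ n j l)%:E));
  last first.
  move=> x xc; have cx := subface_unit_cube xc; congr EFin.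
  rewrite nuE// !dotZr uE// dot_area// uhatE -mulrA mulrAC mulrA mulrA.
  rewrite divfK ?enorm_area_neq0// mulr_sumr.
  by apply: eq_bigr => j _; rewrite mulrA.
rewrite (@iint_tensor _ _ _ _ _ _ (fun j : J m => (-1) ^+ s * cu j)
  (fun (j : J m) l t => t ^+ n j l)).
- rewrite /= mulr_sumr; apply: eq_bigr => j _; rewrite mulrA.
  congr (_ * _); apply: eq_bigr => l _; by rewrite mem_filter mem_enum andbT.
- by move=> j l; exact: exprn_continuous.
- by rewrite filter_uniq// enum_uniq.
Qed.

End PiolaPolynomial.

Lemma volume_dofE (i : K * subbox d p) (w : bscalar R d K) (J : finType)
    (a : J -> R) (n : J -> 'I_d -> nat) :
  (forall x, unit_cube x -> w i.1 (T i.1 x) =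
     (\det (jac T i.1 x))^-1 * \sum_j a j * \prod_l x ord0 l ^+ n j l) ->
  volume_dof T g i w = \sum_j a j * \prod_l
    integral_cc (lo g i.2 ord0 l) (hi g i.2 ord0 l) (fun t => t ^+ n j l).
Proof.
move=> wE; rewrite /volume_dof /box_int (@eq_iint _ _ _ _ _ _
  (fun x => (\sum_j a j * \prod_l x ord0 l ^+ n j l)%:E)); last first.
  move=> z zc; have cz : unit_cube z.
    by apply: (@in_unit_cube i.2) => l; have := zc l; rewrite mem_enum.
  by rewrite wE// mulrAC mulVf ?det_jac_neq0// mul1r.
rewrite (@iint_tensor _ _ _ _ _ _ a (fun j l t => t ^+ n j l)).
- by apply: eq_bigr => j _; congr (_ * _); apply: eq_bigr => l _; rewrite mem_enum.
- by move=> j l; exact: exprn_continuous.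
- exact: enum_uniq.
Qed.

End ReferenceElement.

(** * The weak divergence tested on a single subelement *)

Section DivergenceTheorem.
Variables (R : realType) (d p : nat) (K : finType) (Omega : set 'rV[R]_d).
Variable T : K -> 'rV[R]_d -> 'rV[R]_d.
Hypothesis hmesh : is_mesh Omega T.
Variable g : 'I_p.+1 -> R.
Hypothesis hg : gauss_lobatto g.

(** Compact cube that contains the support of every tensor product of the bumps. *)
Let core : set 'rV[R]_d := box (const_mx 4^-1) (const_mx (3 / 4)).

Lemma core_in_cube x : core x -> forall l, 0 < x ord0 l < 1.
Proof. by move=> cx l; have := cx l; rewrite !mxE; lra. Qed.

Lemma core_subset_unit_cube : core `<=` @unit_cube R d.
Proof. by move=> x /core_in_cube cx l; have := cx l; rewrite !mxE; lra. Qed.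

Lemma compact_core : compact core.
Proof.
have := @rV_compact R d (fun=> `[4^-1, 3 / 4]%classic) (fun=> @segment_compact _ _ _).
congr compact; apply/seteqP; split=> x /= cx l; have := cx l.
  by rewrite in_itv/= !mxE.
by rewrite in_itv/= !mxE.
Qed.

(** By conformity a common point lies on a proper face of element [k], so some reference coordinate
    is 0 or 1, which no point of [core] allows. *)
Lemma core_not_in_other_element k k' x : k != k' -> unit_cube x ->
  ~ (T k @` core) (T k' x).
Proof.
move=> kk' cx [q cq qx]; case: hmesh => diffeo _ conf _.
have cubeq := core_subset_unit_cube cq.
have [U [G [[_ cubeU _] [GF _ _]]]] := diffeo k.
case: (conf _ _ kk') => /= [X0|[e [_ [[l el] _ XE _]]]].
  suff : set0 (T k' x) by []. by rewrite -X0; split; [exists q | exists x].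
have [z [cz ze] zq] : (T k @` box_face 0 (@ones R d) e) (T k' x).
  by rewrite -XE; split; [exists q | exists x].
have zqE : z = q by rewrite -(GF z) ?zq -?qx ?GF//; apply: cubeU.
have := core_in_cube cq l; have := ze l; rewrite zqE; case: (e l) el => // s _.
by move=> /(_ s erefl) ->; case: s; rewrite !mxE ltxx ?andbF.
Qed.

(** [Omega] is the interior of the union of the elements, and [T k] maps the unit cube, a
    neighbourhood of each core point, onto a neighbourhood of its image. *)
Lemma core_subset_Omega k : T k @` core `<=` Omega.
Proof.
case: hmesh => diffeo _ _ -> _ [q cq <-].
have [U [G [[_ cubeU oTU] [GF _ [dG _]]]]] := diffeo k.
have Uq : U q by apply/cubeU/core_subset_unit_cube.
have : nbhs (T k q) (T k @` @unit_cube R d).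
  apply: (nbhs_image GF oTU) => //.
    by apply/differentiable_continuous/dG; exists q.
  by apply: nbhs_box => l; rewrite !mxE; exact: core_in_cube.
by apply: (@filterS _ (nbhs (T k q))) => y Ty; exists k.
Qed.

Lemma elem_int_tensor k f (I : finType) (J : I -> finType)
    (a : forall i, J i -> R) (F : forall i, J i -> 'I_d -> R -> R) :
  (forall i j l, continuous (F i j l)) ->
  (forall x, unit_cube x -> f (T k x) * \det (jac T k x) =
     \sum_i \sum_j a i j * \prod_l F i j l (x ord0 l)) ->
  elem_int T k f = \sum_i \sum_j a i j * \prod_l integral_cc 0 1 (F i j l).
Proof.
move=> cF fE; rewrite /elem_int /box_int (@eq_iint _ _ _ _ _ _
  (fun x => (\sum_i \sum_j a i j * \prod_l F i j l (x ord0 l))%:E)); last first.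
  by move=> x cx; rewrite fE// => l; have := cx l; rewrite mem_enum.
rewrite iint_tensor_dep ?enum_uniq//=.
apply: eq_bigr => i _; apply: eq_bigr => j _; congr (_ * _).
by apply: eq_bigr => l _; rewrite mem_enum !mxE.
Qed.

Lemma elem_int_eq0 k f : (forall x, unit_cube x -> f (T k x) = 0) ->
  elem_int T k f = 0.
Proof.
move=> f0; rewrite (@elem_int_tensor k f 'I_0 (fun=> 'I_0) (fun _ _ => 0)
  (fun _ _ _ => cst 0)) ?big_ord0// => [_ _ _|x cx]; first exact: cst_continuous.
by rewrite f0// mul0r big_ord0.
Qed.

Section OneCell.
Variables (k : K) (c : subbox d p) (u : bvector R d K) (w : bscalar R d K).
Variable uhat : 'rV[R]_d -> 'rV[R]_d.
Variables (J : 'I_d -> finType) (cu : forall m, J m -> R).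
Variable n : forall m, J m -> 'I_d -> nat.
Hypothesis uhatE : forall m x,
  uhat x ord0 m = \sum_(j : J m) cu j * \prod_l x ord0 l ^+ n j l.
Hypothesis uE : forall x, unit_cube x ->
  u k (T k x) = (\det (jac T k x))^-1 *: (uhat x *m jac T k x).
Hypothesis n_le : forall m (j : J m) l, (n j l <= p)%N.
Variables (I : finType) (cw : I -> R) (nw : I -> 'I_d -> nat).
Hypothesis wE : forall x, unit_cube x -> w k (T k x) =
  (\det (jac T k x))^-1 * \sum_i cw i * \prod_l x ord0 l ^+ nw i l.
Hypothesis nw_le : forall i l, (nw i l <= p)%N.
Hypothesis divu : weak_div Omega T u w.

(** The test function is the push-forward of a product of bumps adapted to the sides of [c]. All
    exponents are at most [p], so against these polynomials the bumps integrate exactly as the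
    indicator of [c], although their support is unrelated to [c]. *)
Lemma volume_dof_flux : volume_dof T g (k, c) w =
  \sum_m (flux T g k c m true u - flux T g k c m false u).
Proof.
case: (hmesh) => diffeo detT _ _.
have [/= B HB] := choice (fun l => exists_indicator_bump p (lo_lt_hi hg c l)).
pose b l := (B l).1; pose b' l := (B l).2.
have db l (t : R) : is_derive t 1 (b l) (b' l t) by case: (HB l).
have cb' l : continuous (b' l) by case: (HB l).
have b0 l t : ~ (4^-1 <= t <= 3 / 4) -> b l t = 0 by case: (HB l) => _ _ + _ _; apply.
have cb l : continuous (b l).
  by move=> t; apply/differentiable_continuous/derivable1_diffP; case: (db l t).
pose f := tensor_prod b.
have f0 x : ~ core x -> f x = 0.
  move=> /existsNP[l xl]; rewrite /f /tensor_prod (bigD1 l)//= b0 ?mul0r//.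
  by move: xl; rewrite !mxE.
have [U [G [[oU cubeU oTU] [GF C1F C1G]]]] := diffeo k.
have coreU : core `<=` U by move=> x /core_subset_unit_cube/cubeU.
pose h := push_forward (T k) U G f.
have C1f : C1_on [set: 'rV[R]_d] f by exact: C1_on_tensor_prod db cb'.
have th : test_function Omega h.
  apply: (push_forward_test_function GF coreU) => //; first exact: compact_core.
  exact: core_subset_Omega.
have := divu th; rewrite /Omega_int.
(* Only element [k] contributes: [h] and its derivatives vanish off the image of [core], which
   misses every other closed element. *)
rewrite (bigD1 k)//= [X in _ + X]big1 ?addr0; last first.
  move=> k' kk'; apply: elem_int_eq0 => x cx; apply: big1 => l _.
  rewrite (derive_push_forward_eq0 GF coreU f0 C1F compact_core) ?mulr0//.
  by apply: core_not_in_other_element; rewrite // eq_sym.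
rewrite [in RHS](bigD1 k)//= [X in - (_ + X)]big1 ?addr0; last first.
  move=> k' kk'; apply: elem_int_eq0 => x cx.
  rewrite /h (push_forward_eq0 GF f0) ?mulr0//.
  by apply: core_not_in_other_element; rewrite // eq_sym.
(* In the m-th term the factor [b' m] produces minus the difference of the values on the upper and
   lower sides, and the other factors integrate over the face. *)
have -> : elem_int T k (fun y => \sum_l u k y ord0 l * 'D_(delta_mx ord0 l) h y) =
    - \sum_m (flux T g k c m true u - flux T g k c m false u).
  rewrite (@elem_int_tensor k _ 'I_d J cu
    (fun m j l t => t ^+ n j l * (if l == m then b' l else b l) t)).
  - rewrite -sumrN; apply: eq_bigr => m _.
    rewrite !(fluxE hg detT uhatE uE) opprB -sumrB; apply: eq_bigr => j _.
    rewrite -mulrBr; congr (_ * _).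
    rewrite (bigD1 m)//= [X in _ = X - _](bigD1 m)//= [X in _ = _ - X](bigD1 m)//=.
    rewrite !eqxx /=; case: (HB m) => _ _ _ _ ->; last exact: n_le.
    rewrite opprB mulrBl; congr (_ * _ - _ * _); apply: eq_bigr => l /[dup] lm ->.
      by rewrite (negbTE lm); case: (HB l) => _ _ _ -> //; exact: n_le.
    by rewrite (negbTE lm); case: (HB l) => _ _ _ -> //; exact: n_le.
  - move=> m j l t; apply: cvgM; first exact: exprn_continuous.
    by case: ifP => _; [exact: cb' | exact: cb].
  - move=> x cx; have Ux : U x by exact: cubeU.
    have dx := det_jac_neq0 detT k cx.
    (* The Piola factor cancels the determinant, and the remaining Jacobian turns the physical
       gradient of [h] into the reference gradient of [f]. *)
    transitivity (\sum_m uhat x ord0 m * tensor_partial b b' m x); last first.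
      apply: eq_bigr => m _; rewrite uhatE mulr_suml; apply: eq_bigr => j _.
      by rewrite -mulrA -big_split.
    transitivity (\sum_l \sum_m uhat x ord0 m *
        (jac T k x m l * 'D_(delta_mx ord0 l) h (T k x))).
      rewrite mulr_suml; apply: eq_bigr => l _.
      rewrite uE// !mxE mulrAC -mulrA mulrAC mulrA mulVf// mul1r.
      by rewrite mulr_sumr; apply: eq_bigr => m _; rewrite mulrC mulrA.
    rewrite exchange_big; apply: eq_bigr => m _; rewrite -mulr_sumr.
    rewrite -(derive_push_forward GF coreU f0 oU oTU C1F C1G C1f compact_core)//.
    by rewrite (derive_tensor_prod db).
have -> : elem_int T k (fun y => w k y * h y) = volume_dof T g (k, c) w.
  rewrite (volume_dofE hg detT (i := (k, c)) wE) /=.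
  rewrite (@elem_int_tensor k _ 'I_1 (fun=> I) (fun _ => cw)
    (fun _ i l t => t ^+ nw i l * b l t)) ?big_ord1.
  - apply: eq_bigr => i _; congr (_ * _); apply: eq_bigr => l _.
    by case: (HB l) => _ _ _ -> //; exact: nw_le.
  - by move=> _ i l t; apply: cvgM; [exact: exprn_continuous | exact: cb].
  - move=> x cx; rewrite big_ord1 /h push_forwardE//; last exact: cubeU.
    rewrite wE// mulrAC (mulrAC _ _ (\det _)) mulVf ?(det_jac_neq0 detT)// mul1r.
    by rewrite mulr_suml; apply: eq_bigr => i _; rewrite -mulrA -big_split.
by move/oppr_inj.
Qed.

End OneCell.
End DivergenceTheorem.

(** * Orientation of shared faces *)

Section OneSidedMotion.
Variable R : realType.

Lemma near_dnbhs_right (P : R -> Prop) (a : R) :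
  (\forall t \near a^', P t) -> \forall t \near a^'+, P t.
Proof.
rewrite /dnbhs /at_right !near_withinE; apply: filterS => t Pt at0.
by apply: Pt; rewrite gt_eqF.
Qed.

(** Continuity decides when [phi 0] exceeds [a]; in case of equality the positive limit [w] of the
    difference quotients does. *)
Lemma near_right_gt (phi : R -> R) (w a : R) :
  h^-1 *: (phi h - phi 0) @[h --> 0^'] --> w -> {for 0, continuous phi} ->
  a <= phi 0 -> (phi 0 = a -> 0 < w) -> \forall t \near 0^'+, a < phi t.
Proof.
move=> dphi cphi; rewrite le_eqVlt => /orP[/eqP -> /(_ erefl) w0|az _].
  have dpos : \forall h \near 0^', 0 < h^-1 *: (phi h - phi 0).
    exact: cvgr_gt dphi _ w0.
  have t0 := nbhs_right_gt (0 : R).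
  have := near_dnbhs_right dpos; apply: filterS2 t0 => t t0.
  by rewrite -[_ *: _]/(_ * _) pmulr_rgt0 ?invr_gt0// subr_gt0.
have : \forall t \near (0 : R), a < phi t by exact: cvgr_gt cphi _ az.
by rewrite /at_right near_withinE; apply: filterS.
Qed.

Lemma near_right_lt (phi : R -> R) (w b : R) :
  h^-1 *: (phi h - phi 0) @[h --> 0^'] --> w -> {for 0, continuous phi} ->
  phi 0 <= b -> (phi 0 = b -> w < 0) -> \forall t \near 0^'+, phi t < b.
Proof.
move=> dphi cphi zb wb.
have := @near_right_gt (fun t => - phi t) (- w) (- b).
rewrite lerN2 oppr_gt0 => H.
have : \forall t \near 0^'+, - b < - phi t.
  apply: H => //; first last.
  - by move=> /oppr_inj/wb.
  - exact: continuousN.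
  - have -> : (fun h => h^-1 *: (- phi h - - phi 0)) =
              (fun h => - (h^-1 *: (phi h - phi 0))).
      by apply/funext => h; rewrite -opprD scalerN.
    exact: cvgN.
apply: (@filterS _ (0^'+)) => t; by rewrite ltrN2.
Qed.

Variable d : nat.
Variables (F G : 'rV[R]_d -> 'rV[R]_d) (U : set 'rV[R]_d).
Hypothesis FK : forall x, U x -> G (F x) = x.
Hypotheses (oU : open U) (oFU : open (F @` U)).
Hypotheses (C1F : C1_on U F) (C1G : C1_on (F @` U) G).

(* The displacement [v] of the image pulls back to [w], which points into the
   box at every coordinate where [x0] sits on its boundary. *)
Lemma image_enters_box (a b x0 w v : 'rV[R]_d) : U x0 -> box a b x0 ->
  v = w *m jacobian F x0 ->
  (forall l, x0 ord0 l = a ord0 l -> 0 < w ord0 l) ->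
  (forall l, x0 ord0 l = b ord0 l -> w ord0 l < 0) ->
  \forall t \near 0^'+, exists2 x : 'rV[R]_d,
    forall l, a ord0 l < x ord0 l < b ord0 l & F x = F x0 + t *: v.
Proof.
move=> Ux0 x0ab vE wa wb.
have dF : differentiable F x0 by exact: C1F.1.
have FUx0 : (F @` U) (F x0) by exists x0.
have dG : differentiable G (F x0) by exact: C1G.1.
(* Near [x0] the map [G \o F] is the identity, so the differential of [G] sends [v] back to [w]. *)
have DGv : 'D_v G (F x0) = w.
  have DFw : 'D_w F x0 = v by rewrite deriveEjacobian.
  have dFw : 'd F x0 w = v by rewrite -deriveE.
  have dGF : differentiable (G \o F) x0 by exact: differentiable_comp.
  have eGF : 'd (G \o F) x0 w = 'd G (F x0) ('d F x0 w).
    exact: (congr1 (fun L : 'rV[R]_d -> 'rV[R]_d => L w) (diff_comp dF dG)).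
  rewrite -dFw.
  transitivity ('d G (F x0) ('d F x0 w)); first exact: (deriveE _ dG).
  rewrite -eGF -[LHS](deriveE w dGF).
  transitivity ('D_w id x0); last exact: derive_id.
  apply: near_eq_derive; near=> z; apply: FK.
  by near: z; exact: open_nbhs_nbhs.
(* The pullback of this straight path by [G] starts at [x0] with velocity [w], so each coordinate
   [phi l] falls under the one-sided criteria. *)
pose path (t : R) := t *: v + F x0.
have path0 : path 0 = F x0 by rewrite /path scale0r add0r.
have cpath : {for 0, continuous path}.
  apply: (@continuousD _ _ _ (fun t : R => t *: v) (cst (F x0))); last first.
    exact: cst_continuous.
  exact: scalel_continuous.
pose phi l (t : R) := G (path t) ord0 l.
have phi0 l : phi l 0 = x0 ord0 l by rewrite /phi path0 FK.
have cphi l : {for 0, continuous (phi l)}.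
  apply: (@continuous_comp _ _ _ (G \o path) (fun z : 'rV[R]_d => z ord0 l)); last first.
    exact: coord_continuous.
  apply: continuous_comp; first exact: cpath.
  by rewrite path0; exact: differentiable_continuous.
have dphi l : h^-1 *: (phi l h - phi l 0) @[h --> 0^'] --> w ord0 l.
  have dGv : derivable G (F x0) v by exact: diff_derivable.
  have := (derivable_mxP _ _ _).1 dGv ord0 l.
  have -> : w ord0 l = 'D_v (fun y => G y ord0 l) (F x0).
    by rewrite -DGv derive_mx// mxE.
  by rewrite /phi path0.
have lower l : \forall t \near 0^'+, a ord0 l < phi l t.
  have /andP[al _] := x0ab l.
  apply: (near_right_gt (dphi l) (cphi l)); rewrite phi0 //.
  exact: wa.
have upper l : \forall t \near 0^'+, phi l t < b ord0 l.
  have /andP[_ bl] := x0ab l.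
  apply: (near_right_lt (dphi l) (cphi l)); rewrite phi0 //.
  exact: wb.
have inFU : \forall t \near 0^'+, (F @` U) (path t).
  have nFU : nbhs (path 0) (F @` U) by rewrite path0; apply: open_nbhs_nbhs.
  have := cpath _ nFU; rewrite /at_right near_withinE.
  by apply: (@filterS _ (nbhs (0 : R))) => t /=.
have inbox : \forall t \near 0^'+, forall l, a ord0 l < phi l t < b ord0 l.
  apply: (@filter_forall _ _ (fun l t => is_true (a ord0 l < phi l t < b ord0 l))) => l.
  by apply: filterS2 (lower l) (upper l) => t ? ?; apply/andP.
apply: filterS2 inFU inbox => t [x Ux xt] tab.
exists x; last by rewrite xt /path addrC.
by move=> l; have := tab l; rewrite /phi -xt FK.
Unshelve. all: by end_near. Qed.

End OneSidedMotion.

(** For a reference component [y] orthogonal to the face on side [e], [(-1) ^+ e * y] is the inward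
    component. Multiplying the equation by the common sign of [e (+) s] and [e' (+) s'] compares the
    two inward components. *)
Lemma signed_pos (R : realType) (e s e' s' : bool) (r r' y y' : R) :
  e (+) s = e' (+) s' ->
  0 < r -> 0 < r' -> (-1) ^+ s * (r * y) = (-1) ^+ s' * (r' * y') ->
  0 < (-1) ^+ e' * y' -> 0 < (-1) ^+ e * y.
Proof.
move=> es r0 r1 E y'0; rewrite -(pmulr_rgt0 _ r0).
suff -> : r * ((-1) ^+ e * y) = r' * ((-1) ^+ e' * y') by rewrite mulr_gt0.
move: es E {y'0}; case: e; case: s; case: e'; case: s' => //= _;
  rewrite ?expr1 ?expr0; lra.
Qed.

(** * Two subelements with a common face *)

Section SharedFace.
Variables (R : realType) (d p : nat) (K : finType) (Omega : set 'rV[R]_d).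
Variable T : K -> 'rV[R]_d -> 'rV[R]_d.
Hypothesis hmesh : is_mesh Omega T.
Variable g : 'I_p.+1 -> R.
Hypothesis hg : gauss_lobatto g.
Hypothesis hsub : subelement_mesh T g.

Let detT k (x : 'rV[R]_d) : unit_cube x -> 0 < \det (jac T k x).
Proof. by case: hmesh => _ + _ _; apply. Qed.

Lemma image_enters_subbox k (c : subbox d p) (x0 w v : 'rV[R]_d) :
  (forall l, lo g c ord0 l <= x0 ord0 l <= hi g c ord0 l) ->
  v = w *m jac T k x0 ->
  (forall l, x0 ord0 l = lo g c ord0 l -> 0 < w ord0 l) ->
  (forall l, x0 ord0 l = hi g c ord0 l -> w ord0 l < 0) ->
  \forall t \near 0^'+, exists2 x : 'rV[R]_d,
    forall l, lo g c ord0 l < x ord0 l < hi g c ord0 l & T k x = T k x0 + t *: v.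
Proof.
move=> x0c vE wlo whi; case: hmesh => diffeo _ _ _.
have [U [G [[oU cubeU oTU] [GF C1F C1G]]]] := diffeo k.
apply: (image_enters_box GF oU oTU C1F C1G _ x0c vE) => //.
exact/cubeU/(in_unit_cube hg x0c).
Qed.

(** By conformity of the subelement mesh a common point would lie on a proper face of the first box,
    against the strict bounds on [x]. *)
Lemma subbox_interiors_disjoint k k' (c c' : subbox d p) (x x' : 'rV[R]_d) :
  (k, c) != (k', c') ->
  (forall l, lo g c ord0 l < x ord0 l < hi g c ord0 l) ->
  (forall l, lo g c' ord0 l < x' ord0 l < hi g c' ord0 l) ->
  T k x <> T k' x'.
Proof.
move=> cc' xc xc' xx'; case: hmesh => diffeo _ _ _.
have closed (b : subbox d p) (y : 'rV[R]_d) :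
    (forall l, lo g b ord0 l < y ord0 l < hi g b ord0 l) -> box (lo g b) (hi g b) y.
  by move=> yb l; have /andP[? ?] := yb l; rewrite !ltW.
have [U [G [[_ cubeU _] [GF _ _]]]] := diffeo k.
case: (hsub cc') => /= [X0|[e [_ [[l el] _ XE _]]]].
  suff : set0 (T k x) by []. rewrite -X0; split.
    by exists x => //; exact: closed.
  by exists x'; [exact: closed | rewrite xx'].
have [z [cz ze] zx] : (T k @` box_face (lo g c) (hi g c) e) (T k x).
  rewrite -XE; split; first by exists x => //; exact: closed.
  by exists x'; [exact: closed | rewrite xx'].
have zE : z = x.
  rewrite -(GF z) ?zx ?GF//; apply/cubeU/(in_unit_cube hg); last exact: cz.
  exact: closed.
have := xc l; have := ze l; rewrite zE; case: (e l) el => // s _.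
by move=> /(_ s erefl) ->; case: s; rewrite ltxx ?andbF.
Qed.

Definition subbox_center (c : subbox d p) : 'rV[R]_d :=
  \row_l ((lo g c ord0 l + hi g c ord0 l) / 2).

(** At this point only coordinate [m] is on the boundary of the box, so a direction enters the box
    as soon as its m-th component has the right sign. *)
Definition subface_center (c : subbox d p) (m : 'I_d) (e : bool) : 'rV[R]_d :=
  update (subbox_center c) m ((if e then hi g c else lo g c) ord0 m).

Lemma subface_centerE (c : subbox d p) m e l : subface_center c m e ord0 l =
  if l == m then (if e then hi g c else lo g c) ord0 m
  else (lo g c ord0 l + hi g c ord0 l) / 2.
Proof. by rewrite !mxE. Qed.

Lemma subface_center_in (c : subbox d p) m e : subface g c m e (subface_center c m e).
Proof.
split=> [l|l s]; rewrite subface_centerE; last by case: eqP => [-> [<-]|].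
have := lo_lt_hi hg c l; case: eqP => [->|_]; last lra.
by case: e => /ltW ->; rewrite lexx.
Qed.

Lemma subface_center_lo (c : subbox d p) m (e : bool) (w : 'rV[R]_d) l :
  0 < (-1) ^+ e * w ord0 m -> subface_center c m e ord0 l = lo g c ord0 l ->
  0 < w ord0 l.
Proof.
rewrite subface_centerE; have lh := lo_lt_hi hg c l.
have [<-|_] := eqVneq l m; last by move=> _ /eqP; rewrite gt_eqF// (midf_lt lh).1.
by case: e; rewrite ?expr0 ?mul1r// => _ /eqP; rewrite gt_eqF.
Qed.

Lemma subface_center_hi (c : subbox d p) m (e : bool) (w : 'rV[R]_d) l :
  0 < (-1) ^+ e * w ord0 m -> subface_center c m e ord0 l = hi g c ord0 l ->
  w ord0 l < 0.
Proof.
rewrite subface_centerE; have lh := lo_lt_hi hg c l.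
have [<-|_] := eqVneq l m; last by move=> _ /eqP; rewrite lt_eqF// (midf_lt lh).2.
by case: e; rewrite ?expr1 ?mulN1r ?oppr_gt0// => _ /eqP; rewrite lt_eqF.
Qed.

Lemma to_subbox_center_lo (c : subbox d p) (x : 'rV[R]_d) l :
  x ord0 l = lo g c ord0 l -> 0 < (subbox_center c - x) ord0 l.
Proof.
have := lo_lt_hi hg c l; rewrite !mxE => lh ->.
by rewrite subr_gt0 (midf_lt lh).1.
Qed.

Lemma to_subbox_center_hi (c : subbox d p) (x : 'rV[R]_d) l :
  x ord0 l = hi g c ord0 l -> (subbox_center c - x) ord0 l < 0.
Proof.
have := lo_lt_hi hg c l; rewrite !mxE => lh ->.
by rewrite subr_lt0 (midf_lt lh).2.
Qed.

Lemma to_subbox_center_face (c : subbox d p) m (e : bool) (x : 'rV[R]_d) :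
  subface g c m e x -> 0 < (-1) ^+ e * (subbox_center c - x) ord0 m.
Proof.
case=> _ /(_ m e); rewrite eqxx => /(_ erefl) xm.
case: e xm => xm; rewrite ?expr0 ?mul1r ?expr1 ?mulN1r ?oppr_gt0.
  exact: to_subbox_center_hi.
exact: to_subbox_center_lo.
Qed.

(* If the two outward normals agreed, a displacement pointing into one box
   would also point into the other, and the two interiors would meet. *)
Lemma shared_face_orientation k k' (c c' : subbox d p) m m' (e e' s s' : bool)
    (nu : 'rV[R]_d -> 'rV[R]_d) :
  (k, c) != (k', c') -> T k @` subface g c m e = T k' @` subface g c' m' e' ->
  (forall x, subface g c m e x ->
     nu (T k x) = (-1) ^+ s *: ((enorm (area T k m x))^-1 *: area T k m x)) ->
  (forall x, subface g c' m' e' x ->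
     nu (T k' x) = (-1) ^+ s' *: ((enorm (area T k' m' x))^-1 *: area T k' m' x)) ->
  e (+) s != e' (+) s'.
Proof.
move=> cc' FF' nuE nuE'; apply/negP => /eqP es.
have [x0 fx0 [x0lo x0hi]] : exists2 x0, subface g c m e x0 &
    (forall w : 'rV[R]_d, 0 < (-1) ^+ e * w ord0 m ->
       forall l, x0 ord0 l = lo g c ord0 l -> 0 < w ord0 l) /\
    (forall w : 'rV[R]_d, 0 < (-1) ^+ e * w ord0 m ->
       forall l, x0 ord0 l = hi g c ord0 l -> w ord0 l < 0).
  exists (subface_center c m e); first exact: subface_center_in.
  by split=> w w0 l; [exact: subface_center_lo | exact: subface_center_hi].
have [x1 fx1 x10] : (T k' @` subface g c' m' e') (T k x0) by rewrite -FF'; exists x0.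
have cx0 := subface_unit_cube hg fx0; have cx1 := subface_unit_cube hg fx1.
(* In the second box the same physical point may lie on several faces; the direction towards the
   centre of that box is inward for all of them. *)
have [w1 [w1m w1lo w1hi]] : exists w1 : 'rV[R]_d,
    [/\ 0 < (-1) ^+ e' * w1 ord0 m',
        forall l, x1 ord0 l = lo g c' ord0 l -> 0 < w1 ord0 l
      & forall l, x1 ord0 l = hi g c' ord0 l -> w1 ord0 l < 0].
  exists (subbox_center c' - x1); split; first exact: to_subbox_center_face.
    by move=> l; exact: to_subbox_center_lo.
  by move=> l; exact: to_subbox_center_hi.
(* [w0] and [w1] are the reference directions, in the two elements, of one physical displacement
   [v]. *)
have [v vE1] : exists v, v = w1 *m jac T k' x1 by eexists.
have [w0 vE0] : exists w0, v = w0 *m jac T k x0.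
  exists (v *m invmx (jac T k x0)); rewrite mulmxKV//.
  by rewrite unitmxE unitfE (det_jac_neq0 detT).
have [r0 r0_gt0 nuv0] := dot_normal detT cx0 vE0 (nuE _ fx0).
have [r1 r1_gt0 nuv1] := dot_normal detT cx1 vE1 (nuE' _ fx1).
have w0m : 0 < (-1) ^+ e * w0 ord0 m.
  by apply: signed_pos es r0_gt0 r1_gt0 _ w1m; rewrite -nuv0 -nuv1 x10.
have enter0 := image_enters_subbox fx0.1 vE0 (x0lo _ w0m) (x0hi _ w0m).
have enter1 := image_enters_subbox fx1.1 vE1 w1lo w1hi.
have [t [[x xc xt] [x' xc' xt']]] := filter_ex (filterI enter0 enter1).
by apply: (subbox_interiors_disjoint cc' xc xc'); rewrite xt xt' x10.
Qed.

End SharedFace.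

(** * Sign pattern of the divergence matrix *)

Section DivergenceMatrix.
Variables (R : realType) (d p : nat) (K : finType) (Omega : set 'rV[R]_d).
Variable T : K -> 'rV[R]_d -> 'rV[R]_d.
Hypothesis hmesh : is_mesh Omega T.
Variable g : 'I_p.+1 -> R.
Hypothesis hg : gauss_lobatto g.

Let detT k (x : 'rV[R]_d) : unit_cube x -> 0 < \det (jac T k x).
Proof. by case: hmesh => _ + _ _; apply. Qed.

(** Linearity is read off the explicit polynomial formula for [volume_dof]. *)
Lemma volume_dof_sum (i : K * subbox d p) N (psi : 'I_N -> bscalar R d K)
    (a : 'I_N -> R) (J : finType) (cpsi : 'I_N -> J -> R) (n : J -> 'I_d -> nat) :
  (forall i' x, unit_cube x -> psi i' i.1 (T i.1 x) =
     (\det (jac T i.1 x))^-1 * \sum_j cpsi i' j * \prod_l x ord0 l ^+ n j l) ->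
  volume_dof T g i (fun k y => \sum_i' a i' * psi i' k y) =
  \sum_i' a i' * volume_dof T g i (psi i').
Proof.
move=> psiE; under eq_bigr do rewrite (volume_dofE hg detT (psiE _)) mulr_sumr.
rewrite exchange_big.
rewrite (@volume_dofE _ _ _ _ _ _ hg detT i _ J (fun j => \sum_i' a i' * cpsi i' j) n).
  apply: eq_bigr => j _; rewrite mulr_suml; apply: eq_bigr => i' _.
  by rewrite mulrA.
move=> x cx; under eq_bigr do rewrite psiE// mulrCA mulr_sumr.
rewrite -mulr_sumr exchange_big; congr (_ * _); apply: eq_bigr => j _.
by rewrite mulr_suml; apply: eq_bigr => i' _; rewrite mulrA.
Qed.

(** The divergence theorem on the subelement, for a divergence expanded in the basis [psi]. The sign
    [(-1) ^+ (~~ e)] makes each flux outward: plus on upper faces, minus on lower ones. *)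
Lemma volume_dof_weak_div (k : K) (c : subbox d p) (u : bvector R d K) N
    (psi : 'I_N -> bscalar R d K) (a : 'I_N -> R) :
  raviart_thomas Omega T p u -> (forall i, Wh T p (psi i)) ->
  weak_div Omega T u (fun k y => \sum_i a i * psi i k y) ->
  \sum_i a i * volume_dof T g (k, c) (psi i) =
  \sum_m \sum_(e : bool) (-1) ^+ (~~ e) * flux T g k c m e u.
Proof.
move=> [_ /(_ k)[uhat hu uE]] Wpsi divu.
pose cu m := projT1 (cid (hu m)); have cuE m := projT2 (cid (hu m)).
have psihat i : exists c : {dffun forall l : 'I_d, 'I_(p.-1).+1} -> R,
    forall x, unit_cube x -> psi i k (T k x) =
      (\det (jac T k x))^-1 * \sum_j c j * \prod_l x ord0 l ^+ j l.
  have [_ /(_ k)[what [cw cwE] wE]] := Wpsi i.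
  by exists cw => x cx; rewrite wE// cwE.
have [cpsi cpsiE] := choice psihat.
rewrite -(@volume_dof_sum (k, c) N psi a _ cpsi
  (fun j l => nat_of_ord (j l)) cpsiE).
rewrite (@volume_dof_flux _ _ _ _ _ _ hmesh _ hg k c u _ uhat _ cu
  (fun m j l => nat_of_ord (j l)) _ uE _ _ (fun j => \sum_i a i * cpsi i j)
  (fun j l => nat_of_ord (j l)) _ _ divu).
- by apply: eq_bigr => m _; rewrite big_bool /= expr0 mul1r expr1 mulN1r.
- by move=> m x; exact: cuE.
- move=> m j l; have := ltn_ord (j l); rewrite ltnS => /leq_trans; apply.
  by case: ifP => // _; exact: leq_pred.
- move=> x cx; under eq_bigr do rewrite cpsiE// mulrCA mulr_sumr.
  rewrite -mulr_sumr exchange_big; congr (_ * _); apply: eq_bigr => j _.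
  by rewrite mulr_suml; apply: eq_bigr => i' _; rewrite mulrA.
- move=> j l; have := ltn_ord (j l); rewrite ltnS => /leq_trans; apply.
  exact: leq_pred.
Qed.

(** Each subface has some number [j'], and duality makes the degree of freedom of [phi j] on it 1 or
    0 according to whether [j = j']; the flux differs from it by the sign of the chosen normal. *)
Lemma flux_basis M (face : 'I_M -> set 'rV[R]_d) (nu : 'I_M -> 'rV[R]_d -> 'rV[R]_d)
    (phi : 'I_M -> bvector R d K) k (c : subbox d p) m e j :
  face_numbering T g face -> face_normals T g face nu ->
  Vh_basis Omega T g face nu phi ->
  flux T g k c m e (phi j) = 0 \/
  exists s : bool, [/\ face j = T k @` subface g c m e,
    forall x, subface g c m e x ->
      nu j (T k x) = (-1) ^+ s *: ((enorm (area T k m x))^-1 *: area T k m x)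
    & flux T g k c m e (phi j) = (-1) ^+ s].
Proof.
move=> [_ rface] hnu [RT _ dual].
have [j' _ faceE] : range face (T k @` subface g c m e).
  by rewrite rface; exists k, c, m, e.
have [s nuE] := hnu _ _ _ _ _ faceE.
have := dual j _ _ _ _ _ faceE.
have [_ /(_ k)[uhat hu uE]] := RT j.
have cuE m' := projT2 (cid (hu m')).
rewrite (face_dof_flux hg detT cuE uE nuE).
have fluxs : flux T g k c m e (phi j) =
    (-1) ^+ s * ((-1) ^+ s * flux T g k c m e (phi j)).
  by rewrite mulrA -expr2 sqrr_sign mul1r.
have [jj'|_] := eqVneq j j' => E; rewrite fluxs E; last by left; rewrite mulr0.
by right; exists s; rewrite mulr1 jj'.
Qed.

(** Both entries are sums of outward fluxes of [phi j]. The product is expanded over pairs of faces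
    of the two subelements, and a pair contributes only if both are face [j]. *)
Lemma divergence_matrix_sign N M (cell : 'I_N -> K * subbox d p)
    (face : 'I_M -> set 'rV[R]_d) (nu : 'I_M -> 'rV[R]_d -> 'rV[R]_d)
    (phi : 'I_M -> bvector R d K) (psi : 'I_N -> bscalar R d K) (D : 'M[R]_(N, M)) :
  subelement_mesh T g -> injective cell ->
  face_numbering T g face -> face_normals T g face nu ->
  Vh_basis Omega T g face nu phi -> Wh_basis T g cell psi ->
  divergence_matrix Omega T phi psi D ->
  forall i i' j, i != i' -> D i j * D i' j <= 0.
Proof.
move=> hsub icell hface hnu hphi [Wpsi _ dualpsi] hD i i' j ii'.
have DE i0 : D i0 j = \sum_m \sum_(e : bool)
    (-1) ^+ (~~ e) * flux T g (cell i0).1 (cell i0).2 m e (phi j).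
  have [RT _ _] := hphi.
  (* Duality of [psi] reduces the sum over the volume degrees of freedom to the single entry
     [D i0 j]. *)
  rewrite -(volume_dof_weak_div (cell i0).1 (cell i0).2 (RT j) Wpsi (hD j)).
  rewrite -surjective_pairing (bigD1 i0)//= dualpsi eqxx mulr1 big1 ?addr0//.
  by move=> i1 /negbTE i10; rewrite dualpsi i10 mulr0.
rewrite !DE mulr_suml; apply: sumr_le0 => m _.
rewrite mulr_sumr; apply: sumr_le0 => m' _.
rewrite mulr_suml; apply: sumr_le0 => e _.
rewrite mulr_sumr; apply: sumr_le0 => e' _.
have cc' : ((cell i).1, (cell i).2) != ((cell i').1, (cell i').2).
  by rewrite -!surjective_pairing; apply: contraNneq ii' => /icell ->.
have [->|[s [F nuE ->]]] := flux_basis (cell i).1 (cell i).2 m e j hface hnu hphi.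
  by rewrite mulr0 mul0r.
have [->|[s' [F' nuE' ->]]] :=
  flux_basis (cell i').1 (cell i').2 m' e' j hface hnu hphi.
  by rewrite !mulr0.
(* The outward signs of [nu j] relative to the two subelements are opposite, so the product of the
   four signs is -1. *)
have := shared_face_orientation hmesh hg hsub cc' (etrans (esym F) F') nuE nuE'.
rewrite -!signr_addb; move: e s e' s' {nuE nuE' F F'} => [] [] [] [] //= _;
  by rewrite ?expr1 ?expr0; lra.
Qed.

End DivergenceMatrix.

Theorem proposition4 (R : realType) (d p : nat)
    (hd : d = 2%N \/ d = 3%N) (hp : (1 <= p)%N)
    (K : finType) (Omega : set 'rV[R]_d) (T : K -> 'rV[R]_d -> 'rV[R]_d)
    (hmesh : is_mesh Omega T)
    (g : 'I_p.+1 -> R) (hg : gauss_lobatto g)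
    (hsub : subelement_mesh T g)
    (N M : nat)
    (cell : 'I_N -> K * subbox d p) (hcell : bijective cell)
    (face : 'I_M -> set 'rV[R]_d) (hface : face_numbering T g face)
    (nu : 'I_M -> 'rV[R]_d -> 'rV[R]_d) (hnu : face_normals T g face nu)
    (phi : 'I_M -> bvector R d K) (hphi : Vh_basis Omega T g face nu phi)
    (psi : 'I_N -> bscalar R d K) (hpsi : Wh_basis T g cell psi)
    (D : 'M[R]_(N, M)) (hD : divergence_matrix Omega T phi psi D)
    (alpha beta : 'rV[R]_d -> R)
    (hW : posdef (mass_W T alpha psi))
    (hM : posdef (mass_V T beta phi)) :
  is_M_matrix (invmx (diag_part (mass_W T alpha psi)) +
               D *m invmx (diag_part (mass_V T beta phi)) *m D^T).
Proof.
apply: schur_complement_is_M_matrix.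
- by move=> i; exact: posdef_diag_gt0.
- by move=> j; exact: posdef_diag_gt0.
- exact: (divergence_matrix_sign hmesh hg hsub (bij_inj hcell) hface hnu hphi hpsi hD).
Qed.
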